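(* Let $Z\sim N_d(\theta,\sigma^2 I_d)$ and, independently, $S\sim\sigma^2\chi^2_n$, with $\theta\in\mathbb{R}^d$ and $\sigma^2>0$ both unknown, and let $\hat\sigma^2=s/(n+2)$ and $p>0$. Assume $d\ge 3$ and $0\le\alpha<(d-2)/(d-1)$. Assume $\phi(u)$ is absolutely continuous, monotone non-decreasing and $$0\le\phi(u)\le 2(d-2)\gamma(d,p,\alpha),$$ where $$\gamma(d,p,\alpha)=\min\bigl(1,d^{(2-p-\alpha)/p}\bigr)\left\{1-\alpha\frac{d-1}{d-2}\right\}.$$ Then the shrinkage estimator $\hat\theta_\phi$ with $i$-th component ($i=1,\dots,d$) $$\hat\theta_{i\phi}=\left(1-\frac{\hat\sigma^2\,\phi\bigl(\|z\|_p/\sqrt{\hat\sigma^2}\bigr)}{\|z\|_p^{2-\alpha}|z_i|^{\alpha}}\right)z_i$$ is minimax.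
   Context: For $p>0$, $\|z\|_p=\{\sum_{i=1}^d|z_i|^p\}^{1/p}$; $n\ge 1$ is the degrees of freedom. The lower-case $z,s$ denote the observed values of $Z,S$. The function $\phi$ is a real-valued function of $u\ge 0$. The loss of an estimator $\delta$ is $L(\delta,\theta)=\sum_{i=1}^d(\delta_i-\theta_i)^2/\sigma^2$ and its risk is $E[L(\delta(Z,S),\theta)]$. An estimator is minimax if it minimizes the supremum of the risk over the unknown parameters among all estimators. The estimator $z$ is minimax with constant risk $d$, so $\delta$ is minimax if and only if its risk is at most $d$ for every $\theta$ and $\sigma^2$. The estimator is defined for $z$ with all coordinates nonzero, which holds almost surely. *)

(* Defs.v *)
From HB Require Import structures.
From mathcomp Require Import all_boot all_order all_algebra.
From mathcomp Require Import all_classical all_reals all_analysis.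
From mathcomp Require Import measurable_realfun.

Set Implicit Arguments.
Unset Strict Implicit.
Unset Printing Implicit Defensive.

Import Order.TTheory GRing.Theory Num.Theory.
Import numFieldNormedType.Exports.

Local Open Scope classical_set_scope.
Local Open Scope ring_scope.

(* Vectors of R^d are d-tuples: this is the type carrying the product
   sigma-algebra (the one generated by the coordinates) in the library. *)

Definition tuple_cons (R : realType) (d : nat) (x : R * d.-tuple R) :
  d.+1.-tuple R := [tuple of x.1 :: x.2].

Lemma measurable_tuple_cons (R : realType) (d : nat) :
  measurable_fun [set: R * d.-tuple R] (@tuple_cons R d).
Proof. exact: measurable_cons. Qed.

HB.instance Definition _ (R : realType) (d : nat) :=
  isMeasurableFun.Build _ _ _ _ (@tuple_cons R d)
    (@measurable_tuple_cons R d).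

(* The library defines normal_prob on measurableTypeR R, which has the same
   carrier and the same measurable sets as R, but another measure display; the
   identity transports it to R. *)
Definition ofTypeR (R : realType) (x : measurableTypeR R) : R := x.

Lemma measurable_ofTypeR (R : realType) :
  measurable_fun [set: measurableTypeR R] (@ofTypeR R).
Proof. exact: measurable_id. Qed.

HB.instance Definition _ (R : realType) :=
  isMeasurableFun.Build _ _ _ _ (@ofTypeR R) (@measurable_ofTypeR R).

Definition normal_law (R : realType) (m sigma : R) : probability R R :=
  distribution (normal_prob m sigma) (@ofTypeR R).

(* N_d(theta, sigma^2 I_d), i.e. the product of the normal laws of mean
   theta_i and standard deviation sigma. *)
Fixpoint normal_vec (R : realType) (d : nat) (sigma : R) :
    d.-tuple R -> probability (d.-tuple R) R :=
  match d with
  | 0 => fun=> dirac [tuple]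
  | d'.+1 => fun theta =>
      distribution
        (normal_law (thead theta) sigma \x
           @normal_vec R d' sigma [tuple of behead theta])%E
        (@tuple_cons R d')
  end.

Definition sum_sqr (R : realType) (n : nat) (sigma2 : R) (x : n.-tuple R) : R :=
  sigma2 * \sum_(j < n) tnth x j ^+ 2.

Lemma measurable_sum_sqr (R : realType) (n : nat) (sigma2 : R) :
  measurable_fun [set: n.-tuple R] (@sum_sqr R n sigma2).
Proof.
apply: measurable_funM => //; apply: measurable_sum => j.
by apply: measurable_funX; exact: measurable_tnth.
Qed.

HB.instance Definition _ (R : realType) (n : nat) (sigma2 : R) :=
  isMeasurableFun.Build _ _ _ _ (@sum_sqr R n sigma2)
    (@measurable_sum_sqr R n sigma2).

(* sigma^2 chi^2_n, the law of sigma^2 (X_1^2 + ... + X_n^2) for X_1, ..., X_n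
   independent standard normal variables. *)
Definition scaled_chi2 (R : realType) (n : nat) (sigma2 : R) : probability R R :=
  distribution (normal_vec 1 (nseq_tuple n (0 : R))) (@sum_sqr R n sigma2).

(* The joint law of (Z, S); independence is the product measure. *)
Definition sample_law (R : realType) (d n : nat) (theta : d.-tuple R)
    (sigma2 : R) : probability (d.-tuple R * R)%type R :=
  (normal_vec (Num.sqrt sigma2) theta \x scaled_chi2 n sigma2)%E.

Definition loss (R : realType) (d : nat) (a theta : d.-tuple R) (sigma2 : R) : R :=
  \sum_(i < d) (tnth a i - tnth theta i) ^+ 2 / sigma2.

(* An estimator is used through zs |-> delta zs, where zs = (z, s). *)
Definition risk (R : realType) (d n : nat)
    (delta : d.-tuple R * R -> d.-tuple R) (theta : d.-tuple R) (sigma2 : R) :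
    \bar R :=
  ('E_(sample_law n theta sigma2) [fun zs => loss (delta zs) theta sigma2])%E.

Definition sup_risk (R : realType) (d n : nat)
    (delta : d.-tuple R * R -> d.-tuple R) : \bar R :=
  ereal_sup [set r | exists theta : d.-tuple R, exists2 sigma2 : R,
    0 < sigma2 & r = risk n delta theta sigma2].

Definition estimator (R : realType) (d : nat)
    (delta : d.-tuple R * R -> d.-tuple R) : Prop :=
  measurable_fun [set: d.-tuple R * R] delta.

Definition minimax (R : realType) (d n : nat)
    (delta : d.-tuple R * R -> d.-tuple R) : Prop :=
  estimator delta /\
  forall delta' : d.-tuple R * R -> d.-tuple R,
    estimator delta' -> (sup_risk n delta <= sup_risk n delta')%E.

Definition lp_norm (R : realType) (d : nat) (p : R) (z : d.-tuple R) : R :=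
  (\sum_(i < d) `|tnth z i| `^ p) `^ p^-1.

(* A list of pairs (a_k, b_k) stands for a finite family of non-overlapping
   subintervals [a_k, b_k] of [a, b]. *)
Definition nonoverlapping (R : realType) (a b : R) (s : seq (R * R)) : bool :=
  all (fun I => [&& a <= I.1, I.1 <= I.2 & I.2 <= b]) s &&
  pairwise (fun I J => (I.2 <= J.1) || (J.2 <= I.1)) s.

Definition abs_continuous (R : realType) (a b : R) (f : R -> R) : Prop :=
  forall e : R, 0 < e -> exists2 eta : R, 0 < eta &
    forall s : seq (R * R), nonoverlapping a b s ->
      \sum_(I <- s) (I.2 - I.1) < eta ->
      \sum_(I <- s) `|f I.2 - f I.1| < e.

(* Absolute continuity on the half-line [0, +oo[, i.e. on each compact
   subinterval.  For a bounded monotone f this is equivalent to the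
   epsilon-delta condition with families of subintervals of [0, +oo[. *)
Definition abs_continuous_nonneg (R : realType) (f : R -> R) : Prop :=
  forall b : R, 0 < b -> abs_continuous 0 b f.

Definition gamma_bound (R : realType) (d : nat) (p alpha : R) : R :=
  Num.min 1 (d%:R `^ ((2 - p - alpha) / p)) *
  (1 - alpha * ((d%:R - 1) / (d%:R - 2))).

(* When z_i = 0 the i-th component is 0, whatever the value given to the
   quotient; this concerns a null set only. *)
Definition theta_hat (R : realType) (d n : nat) (p alpha : R) (phi : R -> R)
    (zs : d.-tuple R * R) : d.-tuple R :=
  let: (z, s) := zs in
  let sigma2_hat := s / (n%:R + 2) in
  [tuple (1 - sigma2_hat * phi (lp_norm p z / Num.sqrt sigma2_hat) /
              (lp_norm p z `^ (2 - alpha) * `|tnth z i| `^ alpha)) * tnth z i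
  | i < d].

(* Main.v *)
Require Import Defs.
From HB Require Import structures.
From mathcomp Require Import all_boot all_order all_algebra.
From mathcomp Require Import all_classical all_reals all_analysis.
From mathcomp Require Import measurable_realfun.
From mathcomp Require Import ring lra.

(** The estimator z has risk d everywhere, and no estimator does better in the
    worst case: for sigma^2 = 1 and theta drawn from N(0, tau^2 I), the posterior
    variance of each coordinate is tau^2 / (1 + tau^2), so the maximal risk of any
    estimator is at least d tau^2 / (1 + tau^2), hence at least d on letting tau
    grow ([posterior_loss_ge], [sup_risk_ge]). It remains to bound the risk of the
    shrinkage estimator by d at every parameter.

    Put v = s / (n + 2), N the l^p norm of z, phi = phi (N / sqrt v),
    h_i = z_i / (N^(2-alpha) |z_i|^alpha) and D_i the partial derivative of h_i
    along the i-th axis, so that the estimator is z_i - v phi h_i. The loss is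
    the sum over i of
      (z_i - theta_i)^2 / sigma^2 + A_i - 2 B_i,  plus
      v phi (phi sum h_i^2 - 2 sum D_i),  where
      A_i = phi^2 h_i^2 (v^2 / sigma^2 - v)  and
      B_i = (v phi / sigma^2) ((z_i - theta_i) h_i - sigma^2 D_i).
    The squares have mean d in all, and the other terms only lower the risk.

    - The last term is nonpositive at every z ([shrink_divergence_bound]). This
      is where the upper bound on phi is used: two Chebyshev sum inequalities and
      the comparison of l^q norms on the l^p sphere produce gamma.
    - A_i has nonpositive mean. With z fixed, phi^2 decreases with s, and
      E[S^2] = (n + 2) sigma^2 E[S], so that S (S - (n + 2) sigma^2) is centred and
      is negatively correlated with phi^2 ([chi2_nonincreasing_weight]).
    - B_i has nonnegative mean. With s and the other coordinates fixed, Stein's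
      identity turns its mean into that of v h_i (d phi / d z_i), which is
      nonnegative as phi increases with |z_i| and h_i has the sign of z_i. In
      place of a derivative of phi, the proof writes the monotone weight as a
      mixture of indicators of half-lines [t, +oo[ of |z_i|; for each of them the
      integral is a boundary term, the value at t of h_i times the Gaussian
      density ([tails_monotone_weight], [stein_inequality]).

    The means of A_i and B_i may be computed one variable at a time because h_i^2
    and D_i are dominated by N^(alpha-2) |z_i|^(-alpha), and this by a product of
    powers of the coordinates, each of exponent above -1 since d >= 3
    ([shrink_weight_le], [integral_powRN_prod_lty]). *)

Set Implicit Arguments.
Unset Strict Implicit.
Unset Printing Implicit Defensive.

Import Order.TTheory GRing.Theory Num.Theory.
Import numFieldNormedType.Exports.

Local Open Scope classical_set_scope.
Local Open Scope ring_scope.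

(** * Gaussian integrals as Lebesgue integrals *)

(** The normal law is defined as the measure of density [normal_pdf], whose
    Radon-Nikodym derivative is therefore almost everywhere that function. *)
Lemma ge0_integral_normal_law (R : realType) (m s : R) (f : R -> \bar R) :
  s != 0 -> measurable_fun [set: R] f -> (forall x, 0 <= f x)%E ->
  (\int[normal_law m s]_x f x =
   \int[lebesgue_measure]_x (f x * (normal_pdf m s x)%:E))%E.
Proof.
move=> s0 mf f0; rewrite ge0_integral_distribution//.
have dom : normal_prob m s `<< (@lebesgue_measure R).
  exact: normal_prob_dominates.
rewrite -(Radon_Nikodym_SigmaFinite.change_of_variables dom)//.
apply: ae_eq_integral => //.
- apply: emeasurable_funM => //.
  exact: measurable_int (Radon_Nikodym_SigmaFinite.f_integrable dom).
- apply: emeasurable_funM => //; apply/measurable_EFinP.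
  exact: measurable_normal_pdf.
- apply: ae_eqe_mul2l; apply: integral_ae_eq => //.
  + exact: Radon_Nikodym_SigmaFinite.f_integrable.
  + by apply/measurable_EFinP; exact: measurable_normal_pdf.
  + by move=> E _ mE; rewrite -Radon_Nikodym_SigmaFinite.f_integral.
Qed.

Lemma FTC2_is_derive (R : realType) (f F : R -> R) (a b : R) : a < b ->
  (forall x, a <= x <= b -> is_derive x 1 F (f x)) ->
  (forall x, a <= x <= b -> {for x, continuous f}) ->
  (\int[lebesgue_measure]_(x in `[a, b]) (f x)%:E = (F b)%:E - (F a)%:E)%E.
Proof.
move=> ab dF cf.
have cF x : a <= x <= b -> {for x, continuous F}.
  by move=> /dF [/derivable1_diffP/differentiable_continuous].
apply: continuous_FTC2 => //.
- apply: continuous_in_subspaceT => x; rewrite inE/= in_itv/=; exact: cf.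
- split.
  + by move=> x; rewrite in_itv/= => /andP[/ltW ax /ltW xb]; case: (dF x); rewrite ?ax.
  + by apply: cvg_at_right_filter; apply: cF; rewrite lexx ltW.
  + by apply: cvg_at_left_filter; apply: cF; rewrite lexx ltW.
- move=> x; rewrite in_itv/= => /andP[/ltW ax /ltW xb]; rewrite derive1E.
  by case: (dF x) => //; rewrite ax.
Qed.

Lemma cvg_integral_nondecreasing_set d (T : measurableType d) (R : realType)
    (mu : {measure set T -> \bar R}) (F : (set T)^nat) (g : T -> R) :
  (forall k, measurable (F k)) -> nondecreasing_seq F ->
  mu.-integrable (\bigcup_k F k) (EFin \o g) ->
  (\int[mu]_(x in F k) (g x)%:E @[k --> \oo] -->
   \int[mu]_(x in \bigcup_k F k) (g x)%:E)%E.
Proof.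
move=> mF ndF ig; have mU : measurable (\bigcup_k F k) by exact: bigcup_measurable.
have FU k : F k `<=` \bigcup_k F k by move=> x Fx; exists k.
rewrite [X in X @ _ --> _](_ : _ = fun k =>
    (\int[mu]_x ((EFin \o g) \_ (F k)) x)%E); last first.
  by apply/funext => k; rewrite integral_mkcond.
rewrite [X in _ --> X]integral_mkcond.
have [] := @dominated_convergence _ _ R mu [set: T] measurableT
  (fun k => (EFin \o g) \_ (F k)) ((EFin \o g) \_ (\bigcup_k F k))
  (fun x => `|((EFin \o g) \_ (\bigcup_k F k)) x|)%E; last by [].
- move=> k; apply/(measurable_restrictT _ (mF k)).1.
  exact: (measurable_funS mU (FU k) (measurable_int _ ig)).
- by apply/(measurable_restrictT _ mU).1; exact: measurable_int ig.
- apply/nearW => x _; have [Ux|Ux] := boolP (x \in \bigcup_k F k).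
    have [K _ FKx] := set_mem Ux.
    apply: cvg_near_cst; exists K => // k /= Kk.
    by rewrite !patchE Ux mem_set//; move: Kk => /ndF/subsetPset; exact.
  apply: cvg_near_cst; apply: nearW => k.
  rewrite !patchE (negbTE Ux); case: ifPn => // /set_mem/FU.
  by move/mem_set; rewrite (negbTE Ux).
- by apply: integrable_abse; apply/integrable_restrict => //; rewrite setTI.
- apply/nearW => x k _; rewrite !patchE; case: ifPn => [/set_mem/FU/mem_set -> //|_].
  by rewrite abse0 abse_ge0.
Qed.

Section normal_density.
Context {R : realType}.
Implicit Types (m s x : R) (n : nat).
Local Notation mu := (@lebesgue_measure R).

Lemma integral_normal_law m s (f : R -> R) :
  s != 0 -> measurable_fun [set: R] f ->
  (\int[normal_law m s]_x (f x)%:E = \int[mu]_x (f x * normal_pdf m s x)%:E)%E.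
Proof.
move=> s0 mf; have mF : measurable_fun [set: R] (EFin \o f) by exact/measurable_EFinP.
rewrite integralE [RHS]integralE; congr (_ - _)%E.
- rewrite ge0_integral_normal_law//; last exact: measurable_funepos.
  apply: eq_integral => x _; rewrite !funeposE -!EFin_max -EFinM.
  by rewrite maxr_pMl ?normal_pdf_ge0// mul0r.
- rewrite ge0_integral_normal_law//; last exact: measurable_funeneg.
  apply: eq_integral => x _; rewrite !funenegE -!EFinN -!EFin_max -EFinM.
  by rewrite maxr_pMl ?normal_pdf_ge0// mul0r mulNr.
Qed.

Lemma integrable_normal_law m s (f : R -> R) :
  s != 0 -> measurable_fun [set: R] f ->
  mu.-integrable [set: R] (fun x => (f x * normal_pdf m s x)%:E) <->
  (normal_law m s).-integrable [set: R] (EFin \o f).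
Proof.
move=> s0 mf.
have mF : measurable_fun [set: R] (EFin \o f) by exact/measurable_EFinP.
have E : (\int[normal_law m s]_x `|(f x)%:E| =
    \int[mu]_x `|(f x * normal_pdf m s x)%:E|)%E.
  rewrite ge0_integral_normal_law//; last exact: measurableT_comp.
  by apply: eq_integral => x _; rewrite !abse_EFin normrM -EFinM (ger0_norm (normal_pdf_ge0 _ _ _)).
split=> /integrableP[_ fin]; apply/integrableP; split => //; rewrite ?E//; last by rewrite -E.
by apply/measurable_EFinP; apply: measurable_funM => //; exact: measurable_normal_pdf.
Qed.

Lemma normal_pdfxE m s x : s != 0 ->
  normal_pdf m s x = normal_peak s * expR (- (x - m) ^+ 2 / (s ^+ 2 *+ 2)).
Proof. by move=> s0; rewrite normal_pdfE. Qed.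

Lemma normal_pdfN m s x : s != 0 -> normal_pdf m s (- x) = normal_pdf (- m) s x.
Proof. by move=> s0; rewrite !normal_pdfxE// opprK -opprD sqrrN. Qed.

Lemma is_derive_normal_pdf m s x : s != 0 ->
  is_derive x 1 (normal_pdf m s) (- ((x - m) / s ^+ 2) * normal_pdf m s x).
Proof.
move=> s0; rewrite normal_pdfE//.
have -> : (fun x : R => normal_peak s * normal_fun m s x) =
    normal_peak s \*: (expR \o (fun x => - (s ^+ 2 *+ 2)^-1 * (x - m) ^+ 2)).
  apply/funext => y /=; congr (_ * expR _); ring.
have d1 : is_derive x 1 (fun x : R => - (s ^+ 2 *+ 2)^-1 * (x - m) ^+ 2) (- ((x - m) / s ^+ 2)).
  have -> : (fun x : R => - (s ^+ 2 *+ 2)^-1 * (x - m) ^+ 2) = (- (s ^+ 2 *+ 2)^-1) \*: ((id - cst m) ^+ 2).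
    by [].
  apply: is_derive_eq.
  rewrite /GRing.scale/=; change ((id - cst m) x) with (x - m); rewrite -mulr_natr; by field.
have := is_deriveZ (normal_peak s) (is_derive1_comp (is_derive_expR _) d1).
move=> /is_derive_eq; apply; rewrite /GRing.scale/= [RHS]mulrCA; congr (_ * _).
rewrite mulrC /normal_fun; congr (_ * expR _).
by rewrite mulNr mulrC -mulNr.
Qed.

(** Against a power, the Gaussian density of variance s^2 loses to that of
    variance 2 s^2: this gives all moments at once. *)
Lemma powers_normal_pdf m s n : s != 0 -> exists2 C, 0 < C &
  forall x, `|x - m| ^+ n * normal_pdf m s x <=
    C * (normal_pdf m (Num.sqrt 2 * s) x + normal_pdf m s x).
Proof.
move=> s0; have s20 : Num.sqrt 2 * s != 0 by rewrite mulf_neq0// gt_eqF// sqrtr_gt0.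
have pk := normal_peak_gt0 s0; have pk2 := normal_peak_gt0 s20.
pose C0 := normal_peak s / normal_peak (Num.sqrt 2 * s) * (4 * s ^+ 2) ^+ n * n`!%:R.
have C00 : 0 <= C0.
  have s2 : 0 <= 4 * s ^+ 2 by rewrite mulr_ge0 ?sqr_ge0.
  by rewrite !mulr_ge0 ?invr_ge0 ?(ltW pk) ?(ltW pk2) ?exprn_ge0.
exists (C0 + 1) => [|x]; first by rewrite ltr_wpDl.
have pdf0 := normal_pdf_ge0 m s x.
pose y := (x - m) ^+ 2 / (4 * s ^+ 2).
have y0 : 0 <= y by rewrite divr_ge0 ?sqr_ge0// mulr_ge0 ?sqr_ge0.
have yn : y ^+ n <= n`!%:R * expR y.
  case: n {C0 C00} => [|n]; first by rewrite expr0 fact0 mul1r; have := expR_ge1Dx y; lra.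
  have := expR_ge1Dxn n y0; set f := (_`!)%:R => H.
  have f0 : 0 < f by rewrite /f ltr0n fact_gt0.
  by rewrite mulrC -ler_pdivrMr//; lra.
have xn : (x - m) ^+ 2 ^+ n = (4 * s ^+ 2) ^+ n * y ^+ n.
  by rewrite -exprMn /y; congr (_ ^+ _); field.
have pE : normal_pdf m s x = normal_peak s * (expR (- y) * expR (- y)).
  by rewrite normal_pdfxE// -expRD; congr (_ * expR _); rewrite /y; field.
have p2E : normal_pdf m (Num.sqrt 2 * s) x = normal_peak (Num.sqrt 2 * s) * expR (- y).
  rewrite normal_pdfxE//; congr (_ * expR _); rewrite exprMn sqr_sqrtr// /y; by field.
have ty : `|x - m| ^+ n <= 1 + (x - m) ^+ 2 ^+ n.
  rewrite -(real_normK (num_real (x - m))) -exprM mulnC exprM.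
  set t := `|_| ^+ n; have : 0 <= t by exact: exprn_ge0.
  by have := sqr_ge0 (t - 1); nra.
have big : (x - m) ^+ 2 ^+ n * normal_pdf m s x <= C0 * normal_pdf m (Num.sqrt 2 * s) x.
  rewrite xn pE p2E /C0.
  have eyy : expR (- y) * expR y = 1 by rewrite -expRD addNr expR0.
  have -> : (4 * s ^+ 2) ^+ n * y ^+ n * (normal_peak s * (expR (- y) * expR (- y))) =
      normal_peak s * (4 * s ^+ 2) ^+ n * y ^+ n * (expR (- y) * expR (- y)) by ring.
  have -> : normal_peak s / normal_peak (Num.sqrt 2 * s) * (4 * s ^+ 2) ^+ n * n`!%:R *
      (normal_peak (Num.sqrt 2 * s) * expR (- y)) =
      normal_peak s * (4 * s ^+ 2) ^+ n * (n`!%:R * expR y) * (expR (- y) * expR (- y)).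
    transitivity (normal_peak s * (4 * s ^+ 2) ^+ n * n`!%:R * expR (- y) * (expR (- y) * expR y)).
      by rewrite eyy; field; rewrite gt_eqF.
    ring.
  apply: ler_wpM2r; first by rewrite mulr_ge0// expR_ge0.
  apply: ler_wpM2l => //.
  by rewrite mulr_ge0 ?(ltW pk)// exprn_ge0// mulr_ge0 ?sqr_ge0.
have p20 := normal_pdf_ge0 m (Num.sqrt 2 * s) x.
nra.
Qed.

End normal_density.

Lemma cvg0_harmonic_bound (R : realType) (u : R^nat) (C : R) :
  (forall k, `|u k| <= C * (k.+1%:R)^-1) -> u k @[k --> \oo] --> (0 : R).
Proof.
move=> uC; have h : (C * harmonic k) @[k --> \oo] --> (0 : R).
  by rewrite -[X in _ --> X](mulr0 C); apply: cvgM; [exact: cvg_cst|exact: cvg_harmonic].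
apply: (@squeeze_cvgr _ _ _ _ (fun k => - (C * harmonic k)) (fun k => C * harmonic k)) => //.
  by apply: nearW => k; rewrite -ler_norml; exact: uC.
by rewrite -oppr0; exact: cvgN.
Qed.

Section moments.
Context {R : realType}.
Implicit Types (m s x : R) (n : nat).
Local Notation mu := (@lebesgue_measure R).

(** The bound makes [F] vanish at both ends of the line. *)
Lemma integral_derive_eq0 (f F : R -> R) m C :
  (forall x, is_derive x 1 F (f x)) -> continuous f ->
  mu.-integrable [set: R] (EFin \o f) -> (forall x, `|x - m| * `|F x| <= C) ->
  (\int[mu]_x (f x)%:E = 0)%E.
Proof.
move=> dF cf fi FC.
pose A k := [set` `[m - k.+1%:R, m + k.+1%:R]] : set R.
have AE k x : A k x = (m - k.+1%:R <= x <= m + k.+1%:R) by rewrite /A/= in_itv.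
have AT : \bigcup_k A k = [set: R].
  apply/seteqP; split => // x _; have [k xk] : exists k : nat, `|x - m| < k%:R.
    by exists (Num.truncn `|x - m|).+1; exact: truncnS_gt.
  exists k => //; rewrite AE.
  have : k%:R <= k.+1%:R :> R by rewrite ler_nat.
  by move: xk; rewrite ltr_norml => /andP[]; lra.
have mA k : measurable (A k) by exact: measurable_itv.
have ndA : nondecreasing_seq A.
  move=> i j ij; apply/subsetPset => x; rewrite !AE.
  by have : i.+1%:R <= j.+1%:R :> R by [rewrite ler_nat ltnS]; lra.
have := @cvg_integral_nondecreasing_set _ _ R mu A f mA ndA; rewrite AT => /(_ fi).
suff : (\int[mu]_(x in A k) (f x)%:E @[k --> \oo] --> 0)%E.
  by move=> h1 h2; exact: cvg_unique h2 h1.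
rewrite (_ : (fun k => _) = fun k => (F (m + k.+1%:R) - F (m - k.+1%:R))%:E); last first.
  apply/funext => k; rewrite /A (@FTC2_is_derive _ f F)// ?EFinB// => [|? _].
    by have : 0 < k.+1%:R :> R by [rewrite ltr0n]; lra.
  exact: cf.
apply: cvg_EFin; first exact: nearW.
apply: (@cvg0_harmonic_bound _ _ (2 * C)) => k /=.
have k0 : 0 < k.+1%:R :> R by rewrite ltr0n.
have := FC (m + k.+1%:R); have := FC (m - k.+1%:R).
have -> : m - k.+1%:R - m = - k.+1%:R :> R by ring.
have -> : m + k.+1%:R - m = k.+1%:R :> R by ring.
rewrite normrN gtr0_norm// => h1 h2.
rewrite ler_pdivlMr//; have := ler_normB (F (m + k.+1%:R)) (F (m - k.+1%:R)).
nra.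
Qed.

Lemma integrable_normal_moment_pdf m s n : s != 0 ->
  mu.-integrable [set: R] (fun x => ((x - m) ^+ n * normal_pdf m s x)%:E).
Proof.
move=> s0; have [C C0 nC] := powers_normal_pdf m n s0.
apply: (@le_integrable _ _ _ mu _ measurableT _
  (fun x => C%:E * ((normal_pdf m (Num.sqrt 2 * s) x)%:E + (normal_pdf m s x)%:E)))%E.
- apply/measurable_EFinP; apply: measurable_funM; last exact: measurable_normal_pdf.
  by apply: measurable_funX; exact: measurable_funB.
- move=> x _; rewrite -EFinD -EFinM !abse_EFin lee_fin.
  rewrite [X in X <= _]normrM normrX (ger0_norm (normal_pdf_ge0 _ _ _)).
  by apply: le_trans (nC x) _; exact: ler_norm.
- apply: integrableZl => //; apply: integrableD => //; exact: integrable_normal_pdf.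
Qed.

Lemma integrable_normal_moment m s n : s != 0 ->
  (normal_law m s).-integrable [set: R] (fun x => ((x - m) ^+ n)%:E).
Proof.
move=> s0; apply/integrable_normal_law => //.
  by apply: measurable_funX; exact: measurable_funB.
exact: integrable_normal_moment_pdf.
Qed.

Lemma bounded_normal_moment m s n : s != 0 ->
  exists C, forall x, `|x - m| * `|(x - m) ^+ n * normal_pdf m s x| <= C.
Proof.
move=> s0; have s20 : Num.sqrt 2 * s != 0 by rewrite mulf_neq0// gt_eqF// sqrtr_gt0.
have [C C0 nC] := powers_normal_pdf m n.+1 s0.
exists (C * (normal_peak (Num.sqrt 2 * s) + normal_peak s)) => x.
rewrite normrM normrX (ger0_norm (normal_pdf_ge0 _ _ _)) mulrA -exprS.
apply: le_trans (nC x) _; rewrite ler_pM2l//.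
by apply: lerD; exact: normal_pdf_ub.
Qed.

Lemma normal_moment1 m s : s != 0 -> (\int[normal_law m s]_x (x - m)%:E = 0)%E.
Proof.
move=> s0; have mB : measurable_fun [set: R] (fun x => x - m) by exact: measurable_funB.
rewrite integral_normal_law//.
have [C FC] := bounded_normal_moment m 0 s0.
have s20 : - s ^+ 2 != 0 by rewrite oppr_eq0 expf_neq0.
apply: (@integral_derive_eq0 (fun x => (x - m) * normal_pdf m s x)
  (fun x => - s ^+ 2 * normal_pdf m s x) m (`|- s ^+ 2| * C)).
- move=> x; have := is_deriveZ (- s ^+ 2) (is_derive_normal_pdf m x s0).
  by move=> /is_derive_eq; apply; rewrite /GRing.scale/=; field.
- move=> x; apply: cvgM; last exact: continuous_normal_pdf.
  by apply: cvgB => //; exact: cvg_cst.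
- by have := integrable_normal_moment_pdf m 1 s0; under eq_fun do rewrite expr1.
- move=> x; rewrite normrM mulrCA ler_pM2l ?normr_gt0//.
  by have := FC x; rewrite expr0 mul1r.
Qed.

(** Integration by parts: the two sides differ by the integral of the derivative
    of [- s ^+ 2 * (x - m) ^+ n.+1 * normal_pdf m s x]. *)
Lemma normal_moment_rec m s n : s != 0 ->
  (\int[normal_law m s]_x ((x - m) ^+ n.+2)%:E =
   (n.+1%:R * s ^+ 2)%:E * \int[normal_law m s]_x ((x - m) ^+ n)%:E)%E.
Proof.
move=> s0; have mX k : measurable_fun [set: R] (fun x => (x - m) ^+ k).
  by apply: measurable_funX; exact: measurable_funB.
rewrite !integral_normal_law//.
have i1 := integrable_normal_moment_pdf m n.+2 s0.
have i2 := integrable_normal_moment_pdf m n s0.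
have i3 : mu.-integrable [set: R]
    (fun x => (n.+1%:R * s ^+ 2)%:E * ((x - m) ^+ n * normal_pdf m s x)%:E)%E.
  exact: integrableZl.
rewrite -integralZl//.
suff : (\int[mu]_x ((x - m) ^+ n.+2 * normal_pdf m s x)%:E -
    \int[mu]_x ((n.+1%:R * s ^+ 2)%:E * ((x - m) ^+ n * normal_pdf m s x)%:E) = 0)%E.
  move/eqP; rewrite sube_eq ?add0e; first by move/eqP.
    exact: (integrable_fin_num measurableT i1).
  by rewrite fin_num_adde_defr.
rewrite -integralB//.
have [C FC] := bounded_normal_moment m n.+1 s0.
have s20 : - s ^+ 2 != 0 by rewrite oppr_eq0 expf_neq0.
transitivity (\int[mu]_x ((x - m) ^+ n.+2 * normal_pdf m s x -
    n.+1%:R * s ^+ 2 * ((x - m) ^+ n * normal_pdf m s x))%:E)%E.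
  by apply: eq_integral => x _; rewrite EFinB EFinM.
apply: (@integral_derive_eq0
  (fun x => (x - m) ^+ n.+2 * normal_pdf m s x - n.+1%:R * s ^+ 2 * ((x - m) ^+ n * normal_pdf m s x))
  (fun x => - s ^+ 2 * ((x - m) ^+ n.+1 * normal_pdf m s x)) m
   (`|- s ^+ 2| * C)).
- move=> x.
  have d1 : is_derive x 1 (fun x : R => (x - m) ^+ n.+1) (n.+1%:R * (x - m) ^+ n).
    have -> : (fun x : R => (x - m) ^+ n.+1) = (id - cst m) ^+ n.+1.
      by rewrite exprfctE.
    apply: is_derive_eq; rewrite /GRing.scale/=.
    by change ((id - cst m) x) with (x - m); rewrite subr0 mulr1.
  have := is_deriveZ (- s ^+ 2) (is_deriveM d1 (is_derive_normal_pdf m x s0)).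
  by move=> /is_derive_eq; apply; rewrite /GRing.scale/= !exprS; field.
- have cX k : continuous (fun x : R => (x - m) ^+ k).
    by move=> x; apply: (@continuous_comp _ _ _ (fun x => x - m) (fun x => x ^+ k));
      [apply: cvgB => //; exact: cvg_cst|exact: exprn_continuous].
  have cp : continuous (normal_pdf m s) by exact: continuous_normal_pdf.
  move=> x; apply: cvgB; first by apply: cvgM; [exact: cX|exact: cp].
  by apply: cvgM; [exact: cvg_cst|apply: cvgM; [exact: cX|exact: cp]].
- apply: eq_integrable (integrableB measurableT i1 i3) => // x _ /=.
- by move=> x; rewrite normrM mulrCA ler_pM2l ?normr_gt0.
Qed.

Lemma normal_moment2 m s : s != 0 -> (\int[normal_law m s]_x ((x - m) ^+ 2)%:E = (s ^+ 2)%:E)%E.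
Proof.
move=> s0; rewrite normal_moment_rec// mul1r.
under eq_integral do rewrite expr0.
by rewrite integral_cst//= mul1e probability_setT mule1.
Qed.

Lemma normal_moment4 m s : s != 0 -> (\int[normal_law m s]_x ((x - m) ^+ 4)%:E = (3 * s ^+ 4)%:E)%E.
Proof.
move=> s0; rewrite normal_moment_rec// normal_moment2// -EFinM; congr EFin; ring.
Qed.

Lemma normal_second_moment m s a : s != 0 ->
  (\int[normal_law m s]_x ((a - x) ^+ 2)%:E = (s ^+ 2 + (a - m) ^+ 2)%:E)%E.
Proof.
move=> s0; transitivity (\int[normal_law m s]_x
    (((x - m) ^+ 2)%:E + ((2 * (m - a))%:E * (x - m)%:E + ((a - m) ^+ 2)%:E)))%E.
  by apply: eq_integral => x _; rewrite -EFinM -!EFinD; congr EFin; ring.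
have i1 : (normal_law m s).-integrable [set: R] (fun x => (2 * (m - a))%:E * (x - m)%:E)%E.
  by apply: integrableZl => //; have := integrable_normal_moment m 1 s0; under eq_fun do rewrite expr1.
have i0 : (normal_law m s).-integrable [set: R] (cst ((a - m) ^+ 2)%:E).
  exact: finite_measure_integrable_cst.
rewrite integralD//; [|exact: integrable_normal_moment|exact: integrableD].
rewrite integralD//.
rewrite integralZl//; last by have := integrable_normal_moment m 1 s0; under eq_fun do rewrite expr1.
by rewrite normal_moment1// mule0 add0e integral_cst//= probability_setT mule1 normal_moment2// -EFinD.
Qed.

End moments.

(** * Stein's inequality for monotone weights *)

Section half_line.
Context {R : realType}.
Local Notation mu := (@lebesgue_measure R).

Lemma le_harmonic_ge0 (r C : R) : (forall k : nat, - (C * k.+1%:R^-1) <= r) -> 0 <= r.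
Proof.
move=> h; have c : (- (C * harmonic k)) @[k --> \oo] --> (0 : R).
  rewrite -[X in _ --> X]oppr0 -[X in - X](mulr0 C).
  by apply: cvgN; apply: cvgM; [exact: cvg_cst|exact: cvg_harmonic].
by apply: (cvgr_to_le c); apply: nearW => k; exact: h.
Qed.

(** The integral of K over ]t, +oo[ is F t, the value at infinity being 0 as
    x F x is bounded. It is approached through the segments
    [t + 1/(k+1), t + k + 2], which stay away from the possible singularity at 0. *)
Lemma tail_integral_ge0 (K F : R -> R) (C t : R) : 0 <= t ->
  (forall x : R, 0 < x -> is_derive x 1 F (- K x)) ->
  (forall x : R, 0 < x -> {for x, continuous K}) ->
  (forall x : R, 0 < x -> 0 <= F x) -> (forall x : R, 0 < x -> x * F x <= C) ->
  mu.-integrable `]0, +oo[ (EFin \o K) ->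
  (0 <= \int[mu]_(x in `]t, +oo[) (K x)%:E)%E.
Proof.
move=> t0 dF cK F0 FC iK.
have [v vE] : {v : nat -> R | forall k, v k = k.+1%:R^-1} by exists (fun k => k.+1%:R^-1).
pose A k := [set` `[t + v k, t + k.+2%:R]] : set R.
have AE k x : A k x = (t + v k <= x <= t + k.+2%:R) by rewrite /A/= in_itv.
have kV k : 0 < v k <= 1 by rewrite vE invr_gt0 ltr0n/= invf_le1 ?ler1n// ltr0n.
have k2 k : 2 <= k.+2%:R :> R by rewrite ler_nat.
have AT : \bigcup_k A k = `]t, +oo[%classic.
  apply/seteqP; split => x /=.
    by move=> [k _]; rewrite AE in_itv/= andbT; have := kV k; lra.
  rewrite in_itv/= andbT => tx.
  pose k := maxn (Num.truncn (x - t)) (Num.truncn (x - t)^-1).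
  exists k => //; rewrite AE.
  have xt : 0 < x - t by lra.
  have h1 : x - t < k.+1%:R.
    apply: lt_le_trans (truncnS_gt _) _.
    by rewrite ler_nat ltnS leq_maxl.
  have h2 : (x - t)^-1 < k.+1%:R.
    apply: lt_le_trans (truncnS_gt _) _.
    by rewrite ler_nat ltnS leq_maxr.
  have h3 : v k < x - t by rewrite vE -[ltRHS]invrK ltf_pV2 ?posrE ?invr_gt0 ?ltr0n.
  have : k.+1%:R <= k.+2%:R :> R by rewrite ler_nat.
  lra.
have mA k : measurable (A k) by exact: measurable_itv.
have ndA : nondecreasing_seq A.
  move=> i j ij; apply/subsetPset => x; rewrite !AE.
  have : i.+2%:R <= j.+2%:R :> R by rewrite ler_nat !ltnS.
  have : v j <= v i by rewrite !vE lef_pV2 ?posrE ?ltr0n// ler_nat ltnS.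
  lra.
have iA : mu.-integrable (\bigcup_k A k) (EFin \o K).
  rewrite AT; apply: integrableS iK => // x; rewrite /= !in_itv/= !andbT; exact: le_lt_trans.
have := @cvg_integral_nondecreasing_set _ _ R mu A K mA ndA iA; rewrite AT => cv.
have fin : (\int[mu]_(x in `]t, +oo[) (K x)%:E)%E \is a fin_num.
  by apply: integrable_fin_num => //; rewrite -AT.
rewrite -(fineK fin) lee_fin; apply: (@le_harmonic_ge0 _ C) => n.
rewrite -lee_fin fineK//; apply: (cvge_to_ge cv); exists n => // k /= nk.
have /andP[h0 h0'] := kV k; have h2 := k2 k.
have E : (\int[mu]_(x in A k) (K x)%:E = (F (t + v k) - F (t + k.+2%:R))%:E)%E.
  have ab : t + v k < t + k.+2%:R by lra.
  have dN x : t + v k <= x <= t + k.+2%:R -> is_derive x 1 (fun x => - F x) (K x).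
    by move=> /andP[xl _]; rewrite -[K x]opprK; apply: is_deriveN; apply: dF; lra.
  have cN x : t + v k <= x <= t + k.+2%:R -> {for x, continuous K}.
    by move=> /andP[xl _]; apply: cK; lra.
  by rewrite (FTC2_is_derive ab dN cN); congr EFin; rewrite opprK addrC.
rewrite E lee_fin.
have u0 : 0 < t + k.+2%:R by lra.
have l0 := F0 (t + v k).
suff : F (t + k.+2%:R) <= C * n.+1%:R^-1.
  have : 0 <= F (t + v k) by [apply: l0; rewrite ltr_wpDl].
  by move: (F _) (F _) (C / _) => a b c; lra.
have n0 : 0 < n.+1%:R :> R by rewrite ltr0n.
rewrite ler_pdivlMr//; apply: le_trans (FC _ u0); rewrite mulrC ler_wpM2r ?F0//.
have : n.+1%:R <= k.+2%:R :> R by rewrite ler_nat ltnS leqW.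
lra.
Qed.

(** The set where a nondecreasing [b] is at least [c] is a half-line, open or
    closed at its infimum. *)
Let upset_integral_ge0 (g b : R -> R) (c : R) :
  (forall t : R, 0 <= t -> (0 <= \int[mu]_(x in `]t, +oo[) (g x)%:E)%E) ->
  measurable_fun (`]0, +oo[ : set R) g ->
  (forall x y : R, 0 < x -> x <= y -> b x <= b y) ->
  (0 <= \int[mu]_(x in `]0%R, +oo[) ((EFin \o g) \_ [set x | (c <= b x)%R]) x)%E.
Proof.
move=> tl mg bm; rewrite -integral_mkcondr.
set U : set R := _ `&` _.
have [->|/set0P [x0 Ux0]] := eqVneq U set0; first by rewrite integral_set0.
have U0 x : U x -> 0 < x by case; rewrite /= in_itv/= andbT.
have Uup x y : U x -> x <= y -> U y.
  move=> Ux xy; have x_gt0 := U0 _ Ux; case: Ux => _ /= cb; split => /=.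
    by rewrite in_itv/= andbT; exact: lt_le_trans xy.
  exact: le_trans (bm _ _ x_gt0 xy).
have hU : has_inf U by split; [exists x0|exists 0 => x /U0/ltW].
have t0 : 0 <= inf U by apply: lb_le_inf; [exists x0|move=> x /U0/ltW].
have up x : inf U < x -> U x.
  by move=> h; have [y Uy yx] := inf_lt hU.1 h; apply: Uup Uy (ltW yx).
have lo x : U x -> inf U <= x by apply: ge_inf; exact: hU.2.
have := tl _ t0.
move: (inf U) t0 up lo => t t0 up lo tt.
have [Ut|Ut] := pselect (U t).
  have -> : U = `[t, +oo[%classic.
    apply/seteqP; split => x /=; rewrite in_itv/= andbT; first exact: lo.
    exact: Uup Ut.
  rewrite integral_itv_obnd_cbnd// in tt.
  apply/measurable_EFinP; apply: measurable_funS mg => // x; rewrite /= !in_itv/= !andbT; exact: le_lt_trans.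
suff -> : U = `]t, +oo[%classic by [].
apply/seteqP; split => x /=; rewrite in_itv/= andbT; last exact: up.
move=> Ux; have := lo _ Ux; rewrite le_eqVlt => /predU1P[xU|//].
by exfalso; apply: Ut; rewrite xU.
Qed.

(** The floor of [y] on the grid of step [h]: a staircase approximation by
    indicators of up-sets. *)
Let stair_bounds (h y : R) N : 0 < h -> 0 <= y -> y <= N%:R * h ->
  y - h <= \sum_(j < N) h * (j.+1%:R * h <= y)%R%:R <= y.
Proof.
move=> h0 y0 yN; set S := \sum_(j < N) _.
suff : [/\ S <= y, S <= N%:R * h & (y - h <= S) \/ (N%:R * h <= S)].
  by move=> [-> _ [->//|H]]; rewrite andbT; lra.
rewrite {yN}/S; elim: N => [|N [IH1 IH2 IH3]].
  by rewrite big_ord0 mul0r; split => //; right.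
rewrite big_ord_recr/=; set S := \sum_(j < N) _ in IH1 IH2 IH3 *.
have -> : N.+1%:R * h = N%:R * h + h by rewrite -natr1 mulrDl mul1r.
have [H|H] := boolP (_ <= y); rewrite /= ?mulr1 ?mulr0 ?addr0.
  by split; [|lra|right]; case: IH3; lra.
by rewrite -ltNge in H; split; [lra|lra|left; case: IH3; lra].
Qed.

(** A signed density all of whose right tails have nonnegative mass still has
    nonnegative mass once weighted by a nondecreasing function, which is a
    mixture of indicators of tails. This replaces an integration by parts in
    which the weight would be differentiated. *)
Lemma tails_monotone_weight (g b : R -> R) (B : R) :
  mu.-integrable `]0, +oo[ (EFin \o g) ->
  (forall t : R, 0 <= t -> (0 <= \int[mu]_(x in `]t, +oo[) (g x)%:E)%E) ->
  measurable_fun [set: R] b ->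
  (forall x y : R, 0 < x -> x <= y -> b x <= b y) ->
  (forall x : R, 0 < x -> 0 <= b x <= B) ->
  (0 <= \int[mu]_(x in `]0%R, +oo[) (b x * g x)%:E)%E.
Proof.
move=> ig tl mb bm bB.
have mg : measurable_fun (`]0, +oo[ : set R) g by apply/measurable_EFinP; exact: measurable_int ig.
have mD : measurable (`]0%R, +oo[%classic : set R) by [].
have B0 : 0 <= B by have := bB 1 ltr01; lra.
have iabs : mu.-integrable `]0, +oo[ (EFin \o (fun x => `|g x|)) by exact: integrable_norm.
have ibg : mu.-integrable `]0, +oo[ (EFin \o (fun x => b x * g x)).
  apply: (@le_integrable _ _ _ mu _ mD _ (fun x => B%:E * `|g x|%:E))%E.
  - by apply/measurable_EFinP; apply: measurable_funM => //; exact: measurable_funTS.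
  - move=> x; rewrite /= in_itv/= andbT => x0.
    rewrite lee_fin !normrM normr_id (ger0_norm B0) ler_wpM2r//.
    by have := bB x x0; rewrite ler_norml; lra.
  - exact: integrableZl.
pose I := fine (\int[mu]_(x in `]0%R, +oo[) `|g x|%:E)%E.
have IE : (\int[mu]_(x in `]0%R, +oo[) `|g x|%:E)%E = I%:E.
  by rewrite fineK//; exact: integrable_fin_num.
have fin : (\int[mu]_(x in `]0%R, +oo[) (b x * g x)%:E)%E \is a fin_num.
  exact: integrable_fin_num.
rewrite -(fineK fin) lee_fin; apply: (@le_harmonic_ge0 _ ((B + 1) * I)) => n.
rewrite -lee_fin fineK//.
pose h := (B + 1) / n.+1%:R.
have h0 : 0 < h by rewrite divr_gt0 ?ltr0n//; lra.
pose s j : R -> \bar R := (fun x => h%:E * ((EFin \o g) \_ [set x | (j.+1%:R * h <= b x)%R]) x)%E.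
have mU c : measurable [set x | c <= b x].
  have -> : [set x | c <= b x] = b @^-1` `[c, +oo[.
    by apply/seteqP; split => x /=; rewrite in_itv/= andbT.
  by rewrite -[X in measurable X]setTI; exact: mb.
have iu c : mu.-integrable `]0%R, +oo[ ((EFin \o g) \_ [set x | (c <= b x)%R]).
  apply/integrable_restrict => //; first exact: mU.
  by apply: (@integrableS _ _ _ mu `]0%R, +oo[) => //; apply: measurableI => //; exact: mU.
have is_ j : mu.-integrable `]0%R, +oo[ (s j).
  by apply: integrableZl => //; exact: iu.
have -> : (- ((B + 1) * I * n.+1%:R^-1))%:E =
    (\int[mu]_(x in `]0%R, +oo[) ((- h)%:E * `|g x|%:E))%E.
  rewrite integralZl//= IE -EFinM; congr EFin; rewrite /h; field.
  by rewrite nat1r pnatr_eq0.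
have s0 : (0 <= \int[mu]_(x in `]0%R, +oo[) \sum_(j < n.+1) s j x)%E.
  rewrite integral_sum//; apply: sume_ge0 => j _.
  rewrite integralZl//; first by rewrite mule_ge0 ?lee_fin ?(ltW h0)//; exact: upset_integral_ge0.
have iN : mu.-integrable `]0%R, +oo[ (fun x => (- h)%:E * `|g x|%:E)%E.
  exact: integrableZl.
apply: (@le_trans _ _ (\int[mu]_(x in `]0%R, +oo[) (\sum_(j < n.+1) s j x + (- h)%:E * `|g x|%:E))%E).
  rewrite integralD//; last exact: integrable_sum.
  by rewrite leeDr.
apply: le_integral => //.
  by apply: integrableD => //; exact: integrable_sum.
move=> x; rewrite inE/= in_itv/= andbT => x0.
have sE : (\sum_(j < n.+1) s j x = ((\sum_(j < n.+1) h * (j.+1%:R * h <= b x)%R%:R) * g x)%:E)%E.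
  rewrite mulr_suml -sumEFin; apply: eq_bigr => j _.
  rewrite /s patchE.
  have -> : (x \in [set y | j.+1%:R * h <= b y]) = (j.+1%:R * h <= b x).
    by apply/idP/idP => [/set_mem|/mem_set].
  by case: (j.+1%:R * h <= b x); rewrite /= ?(mulr1, mulr0, mul0r, mule0)// EFinM.
rewrite sE -EFinM -EFinD lee_fin mulNr.
have /andP[b0 bB'] := bB x x0.
have /(stair_bounds h0 b0)/andP[] : b x <= n.+1%:R * h.
  by rewrite /h mulrC divfK ?pnatr_eq0//; lra.
set S := \sum_(j < n.+1) _ => S1 S2.
rewrite lerBlDr -lerBlDl -mulrBl.
apply: le_trans (ler_norm _) _; rewrite normrM ler_wpM2r// ler_norml; lra.
Qed.

End half_line.

Section normal_negative_powers.
Context {R : realType}.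
Local Notation mu := (@lebesgue_measure R).

(** The functions to integrate are singular at 0, so the line is folded onto
    the open half-line. *)
Lemma ge0_integral_fold (f : R -> \bar R) :
  measurable_fun [set: R] f -> (forall x, 0 <= f x)%E ->
  (\int[mu]_x f x = \int[mu]_(x in `]0%R, +oo[) f x +
                    \int[mu]_(x in `]0%R, +oo[) f (- x)%R)%E.
Proof.
move=> mf f0.
have mfN : measurable_fun [set: R] (f \o -%R).
  by apply: (measurableT_comp mf); exact: oppr_measurable.
have -> : [set: R] = `]-oo, 0%R[ `|` `[0%R, +oo[ by rewrite setUC -setCitvr setUv.
rewrite ge0_integral_setU//; last 2 first.
- by apply: measurable_funS mf.
- by apply/disj_setPS => x [] /=; rewrite !in_itv/= andbT ltNge => /negP.
rewrite addeC; congr (_ + _)%E.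
  by rewrite integral_itv_obnd_cbnd//; apply: measurable_funS mf.
rewrite integral_itv_bndo_bndc; last by apply: measurable_funS mf.
rewrite integral_itv_obnd_cbnd//; last by apply: measurable_funS mfN.
have -> : (\int[mu]_(x in `[0%R, +oo[) f (- x)%R = \int[mu]_(x in `[0%R, +oo[) (f \o -%R) x)%E by [].
rewrite ge0_integration_by_substitution0//; last by move=> r; exact: f0.
by apply: eq_integral => x _ /=; rewrite opprK.
Qed.

Lemma integrable_powRN01 (e : R) : 0 <= e -> e < 1 ->
  mu.-integrable `]0%R, 1%R] (fun x => (x `^ (- e))%:E).
Proof.
move=> e0 e1.
have [v vE] : {v : nat -> R | forall k, v k = k.+2%:R^-1} by exists (fun k => k.+2%:R^-1).
have kV k : 0 < v k < 1 by rewrite vE invr_gt0 ltr0n/= invf_lt1 ?ltr1n// ltr0n.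
pose A k := [set` `[v k, 1]] : set R.
have AE k x : A k x = (v k <= x <= 1) by rewrite /A/= in_itv.
have AT : \bigcup_k A k = `]0, 1]%classic.
  apply/seteqP; split => x /=.
    by move=> [k _]; rewrite AE in_itv/=; have := kV k; lra.
  rewrite in_itv/= => /andP[x0 x1].
  exists (Num.truncn x^-1) => //; rewrite AE x1 andbT.
  rewrite vE -[leRHS]invrK lef_pV2 ?posrE ?invr_gt0 ?ltr0n//.
  apply: le_trans (ltW (truncnS_gt _)) _.
  by rewrite ler_nat.
have mA k : measurable (A k) by exact: measurable_itv.
have ndA : nondecreasing_seq A.
  move=> i j ij; apply/subsetPset => x; rewrite !AE.
  have : v j <= v i by rewrite !vE lef_pV2 ?posrE ?ltr0n// ler_nat !ltnS.
  lra.
have mp : measurable_fun [set: R] (fun x : R => (x `^ (- e))%:E).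
  by apply/measurable_EFinP; exact: measurable_powR.
apply/integrableP; split; first exact: measurable_funTS.
under eq_integral do rewrite abse_EFin ger0_norm ?powR_ge0//.
apply: (@le_lt_trans _ _ ((1 - e)^-1)%:E); last by rewrite ltry.
have mA' i : measurable_fun (A i) (fun x : R => (x `^ (- e))%:E) by exact: measurable_funTS.
have A0 i x : A i x -> (0 <= (x `^ (- e))%:E)%E by rewrite lee_fin powR_ge0.
have := @ge0_nondecreasing_set_cvg_integral _ (measurableTypeR R) R A _ mu ndA mA mA' A0.
rewrite AT => cv; apply: (cvge_to_le cv).
apply: nearW => k; have /andP[v0 v1] := kV k.
have e1' : 1 - e != 0 by lra.
have dF x : v k <= x <= 1 -> is_derive x 1 (fun y => (1 - e)^-1 * y `^ (1 - e)) (x `^ (- e)).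
  move=> /andP[vx _]; have x0 : 0 < x by exact: lt_le_trans vx.
  have := is_deriveZ (1 - e)^-1 (is_derive1_powR (1 - e) x0).
  move=> /is_derive_eq; apply; rewrite /GRing.scale/= mulrA mulVf// mul1r.
  by congr (_ `^ _); ring.
have cp x : v k <= x <= 1 -> {for x, continuous (fun y => y `^ (- e))}.
  move=> /andP[vx _]; have x0 : 0 < x by exact: lt_le_trans vx.
  apply/differentiable_continuous/derivable1_diffP.
  by have [] := is_derive1_powR (- e) x0.
rewrite (FTC2_is_derive v1 dF cp) -EFinB lee_fin powR1 mulr1 lerBlDr lerDl.
by rewrite mulr_ge0 ?powR_ge0// invr_ge0; lra.
Qed.

Lemma integrable_powRN_pdf (m s e : R) : s != 0 -> 0 <= e -> e < 1 ->
  mu.-integrable `]0%R, +oo[ (fun x => (x `^ (- e) * normal_pdf m s x)%:E).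
Proof.
move=> s0 e0 e1; have ip := integrable_powRN01 e0 e1.
have mp : measurable_fun [set: R] (fun x : R => x `^ (- e)) by exact: measurable_powR.
have mpdf : measurable_fun [set: R] (normal_pdf m s) by exact: measurable_normal_pdf.
apply: (@le_integrable _ _ _ mu _ _ _
  (fun x => (normal_peak s)%:E * ((fun x => (x `^ (- e))%:E) \_ `]0%R, 1%R]) x + (normal_pdf m s x)%:E))%E => //.
- by apply/measurable_EFinP; apply: measurable_funTS; exact: measurable_funM.
- move=> x; rewrite /= in_itv/= andbT => x0.
  have p0 := powR_ge0 x (- e); have n0 := normal_pdf_ge0 m s x.
  have nb := normal_pdf_ub m x s0; have k0 := normal_peak_ge0 s.
  rewrite patchE; have [xi|/negP xi] := boolP (x \in _).
    rewrite -EFinM -EFinD !abse_EFin lee_fin !ger0_norm ?addr_ge0 ?mulr_ge0//; nra.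
  have x1 : 1 < x.
    by rewrite ltNge; apply/negP => x1; apply: xi; rewrite inE/= in_itv/= x0.
  rewrite mule0 add0e !abse_EFin lee_fin !ger0_norm ?mulr_ge0// ler_piMl//.
  by rewrite -(powRr0 x) ler_powR ?(ltW x1)//; lra.
- apply: integrableD => //.
    apply: integrableZl => //; apply/integrable_restrict => //.
    by rewrite setIidr// => x /=; rewrite !in_itv/= => /andP[->].
  exact: (integrableS _ _ (@subsetT _ _) (integrable_normal_pdf m s)).
Qed.

Lemma normal_powRN_lty (m s e : R) : s != 0 -> 0 <= e -> e < 1 ->
  (\int[normal_law m s]_x (`|x| `^ (- e))%:E < +oo)%E.
Proof.
move=> s0 e0 e1.
have mp : measurable_fun [set: R] (fun x : R => `|x| `^ (- e)).
  by apply: (measurableT_comp (measurable_powR _)); exact: normr_measurable.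
rewrite integral_normal_law// ge0_integral_fold; last 2 first.
- by apply/measurable_EFinP; apply: measurable_funM => //; exact: measurable_normal_pdf.
- by move=> x; rewrite lee_fin mulr_ge0 ?powR_ge0 ?normal_pdf_ge0.
have fin m' : (\int[mu]_(x in `]0%R, +oo[) (x `^ (- e) * normal_pdf m' s x)%:E < +oo)%E.
  have /integrableP[_] := integrable_powRN_pdf m' s0 e0 e1.
  under eq_integral do rewrite abse_EFin ger0_norm ?mulr_ge0 ?powR_ge0 ?normal_pdf_ge0//.
  by [].
have E m' : (\int[mu]_(x in `]0%R, +oo[) (`|x| `^ (- e) * normal_pdf m' s x)%:E < +oo)%E.
  have -> : (\int[mu]_(x in `]0%R, +oo[) (`|x| `^ (- e) * normal_pdf m' s x)%:E =
      \int[mu]_(x in `]0%R, +oo[) (x `^ (- e) * normal_pdf m' s x)%:E)%E; last by [].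
  by apply: eq_integral => x; rewrite inE/= in_itv/= andbT => x0; rewrite gtr0_norm.
apply: lte_add_pinfty; first exact: E.
by under eq_integral do rewrite normrN normal_pdfN//; exact: E.
Qed.

End normal_negative_powers.

(** Comparing positive and negative parts, rather than the sign of the integral,
    can be iterated through Tonelli's theorem before integrability is known. *)
Lemma funeneg_le_funeposP d (T : measurableType d) (R : realType)
    (mu : {measure set T -> \bar R}) (D : set T) (f : T -> \bar R) :
  measurable D -> mu.-integrable D f ->
  ((0 <= \int[mu]_(x in D) f x) <->
   (\int[mu]_(x in D) f^\- x <= \int[mu]_(x in D) f^\+ x))%E.
Proof.
move=> mD fi; rewrite [X in (0 <= X)%E]integralE sube_ge0//.
by rewrite (integrable_neg_fin_num mD fi).
Qed.

Section stein_inequality.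
Context {R : realType}.
Local Notation mu := (@lebesgue_measure R).
Variables (s e C B : R) (a a' b : R -> R).
Hypotheses (s0 : s != 0) (e0 : 0 <= e) (e1 : e < 1).
Hypothesis da : forall x : R, 0 < x -> is_derive x 1 a (a' x).
Hypothesis ca' : forall x : R, 0 < x -> {for x, continuous a'}.
Hypothesis a_bd : forall x : R, 0 < x -> 0 <= a x <= C.
Hypothesis a'_bd : forall x : R, 0 < x -> `|a' x| <= C * x `^ (- e).
Hypothesis mb : measurable_fun [set: R] b.
Hypothesis b_mono : forall x y : R, 0 < x -> x <= y -> b x <= b y.
Hypothesis b_bd : forall x : R, 0 < x -> 0 <= b x <= B.

Let G m x := (x - m) * a x - s ^+ 2 * a' x.

Let continuous_a (x : R) : 0 < x -> {for x, continuous a}.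
Proof. by move=> /da [/derivable1_diffP/differentiable_continuous]. Qed.

Let continuous_g m (x : R) : 0 < x ->
  {for x, continuous (fun x => G m x * normal_pdf m s x)}.
Proof.
move=> x0; apply: cvgM; last exact: continuous_normal_pdf.
apply: cvgB; first by apply: cvgM; [apply: cvgB => //; exact: cvg_cst|exact: continuous_a].
by apply: cvgM; [exact: cvg_cst|exact: ca'].
Qed.

Let measurable_g m :
  measurable_fun (`]0, +oo[ : set R) (fun x => G m x * normal_pdf m s x).
Proof.
apply: open_continuous_measurable_fun; first exact: interval_open.
by move=> x; rewrite inE/= in_itv/= andbT; exact: continuous_g.
Qed.

Let integrable_g m :
  mu.-integrable `]0%R, +oo[ (EFin \o (fun x => G m x * normal_pdf m s x)).
Proof.
have C0 : 0 <= C by have := a_bd ltr01; lra.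
have i1 : mu.-integrable `]0%R, +oo[ (fun x => (`|(x - m) ^+ 1 * normal_pdf m s x|)%:E).
  apply: (integrableS measurableT) => //.
  exact: integrable_norm (integrable_normal_moment_pdf m 1 s0).
have i2 := integrable_powRN_pdf m s0 e0 e1.
apply: (@le_integrable _ _ _ mu _ _ _ (fun x => C%:E * `|(x - m) ^+ 1 * normal_pdf m s x|%:E +
   (s ^+ 2 * C)%:E * (x `^ (- e) * normal_pdf m s x)%:E))%E => //.
- by apply/measurable_EFinP; exact: measurable_g.
- move=> x; rewrite /= in_itv/= andbT => x0; rewrite lee_fin expr1.
  apply: le_trans _ (ler_norm _); rewrite !normrM (ger0_norm (normal_pdf_ge0 _ _ _)).
  rewrite !mulrA -mulrDl ler_wpM2r ?normal_pdf_ge0// /G.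
  apply: le_trans (ler_normB _ _) _; rewrite (normrM (x - m)) (normrM (s ^+ 2)).
  have /andP[a0 aC] := a_bd x0.
  apply: lerD; first by rewrite mulrC ler_wpM2r// ger0_norm.
  rewrite (ger0_norm (sqr_ge0 s)) -[leRHS]mulrA ler_wpM2l ?sqr_ge0//; exact: a'_bd.
- by apply: integrableD => //; exact: integrableZl.
Qed.

(* The integral of (x - m) a - s^2 a' against the density over ]t, +oo[ is the
   value at t of s^2 a times the density. *)
Let weighted_half_line m :
  (0 <= \int[mu]_(x in `]0%R, +oo[) (b x * (G m x * normal_pdf m s x))%:E)%E.
Proof.
have C0 : 0 <= C by have := a_bd ltr01; lra.
have s20 : 0 < s ^+ 2 by rewrite exprn_even_gt0.
apply: (@tails_monotone_weight _ (fun x => G m x * normal_pdf m s x) b B) => //.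
move=> t t0.
have [C1 HC1] := bounded_normal_moment m 0 s0.
apply: (@tail_integral_ge0 _ _ (fun x => s ^+ 2 * (a x * normal_pdf m s x))
  (s ^+ 2 * C * (C1 + `|m| * normal_peak s))) => //.
- move=> x x0; have := is_deriveZ (s ^+ 2) (is_deriveM (da x0) (is_derive_normal_pdf m x s0)).
  by move=> /is_derive_eq; apply; rewrite /GRing.scale/= /G; field.
- by move=> x x0; exact: continuous_g.
- move=> x x0; have /andP[a0 _] := a_bd x0.
  by apply: mulr_ge0; [exact: sqr_ge0|apply: mulr_ge0 => //; exact: normal_pdf_ge0].
- move=> x x0; have /andP[a0 aC] := a_bd x0.
  have := HC1 x; rewrite expr0 mul1r (ger0_norm (normal_pdf_ge0 _ _ _)) => h1.
  have n0 := normal_pdf_ge0 m s x; have nb := normal_pdf_ub m x s0.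
  have -> : x * (s ^+ 2 * (a x * normal_pdf m s x)) = s ^+ 2 * (a x * (x * normal_pdf m s x)) by ring.
  rewrite -[leRHS]mulrA ler_wpM2l ?(ltW s20)//.
  apply: (@le_trans _ _ (C * (x * normal_pdf m s x))); first by rewrite ler_wpM2r// mulr_ge0// ltW.
  rewrite ler_wpM2l//.
  apply: (@le_trans _ _ (`|x - m| * normal_pdf m s x + `|m| * normal_pdf m s x)).
    rewrite -mulrDl ler_wpM2r//; have := ler_normD (x - m) m.
    by rewrite subrK gtr0_norm.
  by apply: lerD => //; rewrite ler_wpM2l.
Qed.

Let half_line_neg_le_pos m :
  (\int[mu]_(x in `]0%R, +oo[) (fun x => (b x * (G m x * normal_pdf m s x))%:E)^\- x <=
   \int[mu]_(x in `]0%R, +oo[) (fun x => (b x * (G m x * normal_pdf m s x))%:E)^\+ x)%E.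
Proof.
have B0 : 0 <= B by have := b_bd ltr01; lra.
have ib : mu.-integrable `]0%R, +oo[ (fun x => (b x * (G m x * normal_pdf m s x))%:E).
  apply: (@le_integrable _ _ _ mu _ _ _ (fun x => B%:E * `|G m x * normal_pdf m s x|%:E))%E => //.
  - by apply/measurable_EFinP; apply: measurable_funM => //; [exact: measurable_funTS|exact: measurable_g].
  - move=> x; rewrite /= in_itv/= andbT => x0; rewrite lee_fin !normrM !normr_id (ger0_norm B0).
    by rewrite ler_wpM2r ?mulr_ge0//; have := b_bd x0; rewrite ler_norml; lra.
  - by apply: integrableZl => //; exact: integrable_norm (integrable_g m).
exact: (funeneg_le_funeposP _ ib).1 (weighted_half_line m).
Qed.

(** By Stein's identity the mean of [H] would be s^2 times that of b' a, where
    a is extended as an odd function and b as an even one; this is nonnegative as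
    b increases with |x|. The tails give the sign without differentiating b.
    Reflection maps the negative half-line to the positive one and changes m into
    - m, which explains the third hypothesis. *)
Lemma stein_inequality m (H : R -> R) : measurable_fun [set: R] H ->
  (forall x : R, 0 < x -> H x = b x * ((x - m) * a x - s ^+ 2 * a' x)) ->
  (forall x : R, 0 < x -> H (- x) = b x * ((x + m) * a x - s ^+ 2 * a' x)) ->
  (\int[normal_law m s]_x (EFin \o H)^\- x <= \int[normal_law m s]_x (EFin \o H)^\+ x)%E.
Proof.
move=> mH Hp Hn.
have mH' : measurable_fun [set: R] (EFin \o H) by exact/measurable_EFinP.
have mp : measurable_fun [set: R] (fun x => (normal_pdf m s x)%:E).
  by apply/measurable_EFinP; exact: measurable_normal_pdf.
have mpos := measurable_funepos mH'; have mneg := measurable_funeneg mH'.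
rewrite !ge0_integral_normal_law// !ge0_integral_fold//; last 4 first.
- exact: emeasurable_funM.
- by move=> x; rewrite mule_ge0// lee_fin normal_pdf_ge0.
- exact: emeasurable_funM.
- by move=> x; rewrite mule_ge0// lee_fin normal_pdf_ge0.
have nE (u v : R) : 0 <= v -> ((maxe (- u%:E) 0) * v%:E = maxe (- (u * v)%:E) 0)%E.
  by move=> v0; rewrite -!EFinN -!EFin_max -EFinM maxr_pMl// mul0r mulNr.
have pE (u v : R) : 0 <= v -> ((maxe u%:E 0) * v%:E = maxe (u * v)%:E 0)%E.
  by move=> v0; rewrite -!EFin_max -EFinM maxr_pMl// mul0r.
apply: leeD.
- have := half_line_neg_le_pos m; congr (_ <= _)%E; apply: eq_integral => x; rewrite inE/= in_itv/= andbT => x0.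
  + by rewrite !funenegE/= nE ?normal_pdf_ge0// Hp// mulrA.
  + by rewrite !funeposE/= pE ?normal_pdf_ge0// Hp// mulrA.
- have := half_line_neg_le_pos (- m); congr (_ <= _)%E; apply: eq_integral => x; rewrite inE/= in_itv/= andbT => x0.
  + by rewrite !funenegE/= nE ?normal_pdf_ge0// Hn// normal_pdfN// /G opprK mulrA.
  + by rewrite !funeposE/= pE ?normal_pdf_ge0// Hn// normal_pdfN// /G opprK mulrA.
Qed.

End stein_inequality.

(** * Integrals over the multivariate normal law *)

Section normal_vec_integral.
Context {R : realType}.
Implicit Types (s : R) (d : nat).

Lemma tnth_tuple_cons0 d (x : R) (z : d.-tuple R) : tnth (tuple_cons (x, z)) ord0 = x.
Proof. by rewrite (tnth_nth 0). Qed.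

Lemma tnth_tuple_consS d (x : R) (z : d.-tuple R) (i : 'I_d) :
  tnth (tuple_cons (x, z)) (lift ord0 i) = tnth z i.
Proof. by rewrite !(tnth_nth 0). Qed.

Lemma tnth_beheadS d (theta : d.+1.-tuple R) (i : 'I_d) :
  tnth [tuple of behead theta] i = tnth theta (lift ord0 i).
Proof. by rewrite tnth_behead; congr tnth; apply: val_inj; rewrite /= inordK// ltnS. Qed.

Lemma ge0_integral_normal_vecS s d (theta : d.+1.-tuple R) (f : d.+1.-tuple R -> \bar R) :
  measurable_fun [set: d.+1.-tuple R] f -> (forall z, 0 <= f z)%E ->
  (\int[normal_vec s theta]_z f z =
   \int[normal_law (thead theta) s]_x
     \int[normal_vec s [tuple of behead theta]]_z f (tuple_cons (x, z)))%E.
Proof.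
move=> mf f0; rewrite ge0_integral_distribution// fubini_tonelli1//.
  by apply: (measurableT_comp mf); exact: measurable_tuple_cons.
by move=> x; exact: f0.
Qed.

Lemma integral_normal_vec0 s (theta : 0.-tuple R) (f : 0.-tuple R -> \bar R) :
  measurable_fun [set: 0.-tuple R] f ->
  (\int[normal_vec s theta]_z f z = f [tuple])%E.
Proof. by move=> mf; rewrite integral_dirac// diracT mul1e. Qed.

Lemma measurable_prod_tnth d (f : 'I_d -> R -> R) :
  (forall i, measurable_fun [set: R] (f i)) ->
  measurable_fun [set: d.-tuple R] (fun z => \prod_(i < d) f i (tnth z i)).
Proof.
move=> mf; apply: measurable_prod => i _.
apply: measurableT_comp; [exact: mf|exact: measurable_tnth].
Qed.

Lemma integral_normal_vec_prod s d (theta : d.-tuple R) (f : 'I_d -> R -> R) (c : 'I_d -> R) :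
  (forall i, measurable_fun [set: R] (f i)) -> (forall i x, 0 <= f i x) ->
  (forall i, \int[normal_law (tnth theta i) s]_x (f i x)%:E = (c i)%:E)%E ->
  (\int[normal_vec s theta]_z (\prod_(i < d) f i (tnth z i))%:E = (\prod_(i < d) c i)%:E)%E.
Proof.
elim: d theta f c => [|d IH] theta f c mf f0 fc.
  rewrite integral_normal_vec0; first by rewrite !big_ord0.
  by apply/measurable_EFinP; exact: measurable_prod_tnth.
rewrite ge0_integral_normal_vecS; last 2 first.
- by apply/measurable_EFinP; exact: measurable_prod_tnth.
- by move=> z; rewrite lee_fin prodr_ge0.
transitivity (\int[normal_law (thead theta) s]_x
    ((f ord0 x)%:E * (\prod_(i < d) c (lift ord0 i))%:E))%E.
  apply: eq_integral => x _.
  rewrite -(IH [tuple of behead theta] (fun i => f (lift ord0 i)))//; last first.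
    by move=> i; rewrite tnth_beheadS.
  rewrite -ge0_integralZl//; last 3 first.
  - by apply/measurable_EFinP; apply: (@measurable_prod_tnth _ (fun i => f (lift ord0 i))) => i.
  - by move=> z _; rewrite lee_fin prodr_ge0.
  - by rewrite lee_fin.
  apply: eq_integral => z _; rewrite -EFinM big_ord_recl tnth_tuple_cons0; congr (_ * _)%:E.
  by apply: eq_bigr => i _; rewrite tnth_tuple_consS.
have P0 : 0 <= \prod_(i < d) c (lift ord0 i).
  apply: prodr_ge0 => i _; rewrite -lee_fin -fc; apply: integral_ge0 => x _.
  by rewrite lee_fin.
rewrite ge0_integralZr//; last 2 first.
- by apply/measurable_EFinP; exact: mf.
- by move=> x _; rewrite lee_fin.
by rewrite fc -EFinM big_ord_recl.
Qed.

Definition replace_tnth d (z : d.-tuple R) (i : 'I_d) (x : R) : d.-tuple R :=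
  [tuple if j == i then x else tnth z j | j < d].

(** Coordinates are independent, so an inequality between the integrals along
    every line parallel to one axis passes to the integrals over the space. *)
Lemma integral_normal_vec_slice_le s d (theta : d.-tuple R) (i : 'I_d)
    (f g : d.-tuple R -> \bar R) :
  measurable_fun [set: d.-tuple R] f -> measurable_fun [set: d.-tuple R] g ->
  (forall z, 0 <= f z)%E -> (forall z, 0 <= g z)%E ->
  (forall z, \int[normal_law (tnth theta i) s]_x f (replace_tnth z i x) <=
             \int[normal_law (tnth theta i) s]_x g (replace_tnth z i x))%E ->
  (\int[normal_vec s theta]_z f z <= \int[normal_vec s theta]_z g z)%E.
Proof.
elim: d theta i f g => [|d IH] theta; first by case.
move=> i f g mf mg f0 g0 fg.
have mc (h : d.+1.-tuple R -> \bar R) : measurable_fun [set: d.+1.-tuple R] h ->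
    measurable_fun [set: R * d.-tuple R] (h \o @tuple_cons R d).
  by move=> mh; apply: (measurableT_comp mh); exact: measurable_tuple_cons.
have mcx (h : d.+1.-tuple R -> \bar R) x : measurable_fun [set: d.+1.-tuple R] h ->
    measurable_fun [set: d.-tuple R] (fun z => h (tuple_cons (x, z))).
  by move=> /mc mh; apply: (measurableT_comp mh); exact: pair1_measurable.
rewrite (ge0_integral_normal_vecS _ _ mf f0) (ge0_integral_normal_vecS _ _ mg g0).
case: (unliftP ord0 i) fg => [j|] -> fg.
  apply: ge0_le_integral => //.
  - by move=> x _; apply: integral_ge0 => z _.
  - by apply: (measurable_fun_fubini_tonelli_F (f \o @tuple_cons R d)) => //; [exact: mc|move=> x; exact: f0].
  - by apply: (measurable_fun_fubini_tonelli_F (g \o @tuple_cons R d)) => //; [exact: mc|move=> x; exact: g0].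
  move=> x _; apply: (IH [tuple of behead theta] j (fun z => f (tuple_cons (x, z)))
    (fun z => g (tuple_cons (x, z))) (mcx _ x mf) (mcx _ x mg)).
  - by move=> z; exact: f0.
  - by move=> z; exact: g0.
  move=> z; rewrite tnth_beheadS.
  have E y : tuple_cons (x, replace_tnth z j y) = replace_tnth (tuple_cons (x, z)) (lift ord0 j) y.
    apply: eq_from_tnth => k; rewrite tnth_mktuple.
    case: (unliftP ord0 k) => [k'|] ->.
      rewrite !tnth_tuple_consS tnth_mktuple (inj_eq (@lift_inj _ ord0)).
      by case: ifP.
    by rewrite tnth_tuple_cons0.
  under eq_integral do rewrite E.
  by under [leRHS]eq_integral do rewrite E.
rewrite (fubini_tonelli (f \o @tuple_cons R d)); [|exact: mc|by move=> x; exact: f0].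
rewrite (fubini_tonelli (g \o @tuple_cons R d)); [|exact: mc|by move=> x; exact: g0].
apply: ge0_le_integral => //.
- by move=> x _; apply: integral_ge0 => z _; exact: f0.
- by apply: (measurable_fun_fubini_tonelli_G (f \o @tuple_cons R d)) => //; [exact: mc|move=> x; exact: f0].
- by apply: (measurable_fun_fubini_tonelli_G (g \o @tuple_cons R d)) => //; [exact: mc|move=> x; exact: g0].
move=> z _ /=; have := fg (tuple_cons (0, z)).
have E y : replace_tnth (tuple_cons (0, z)) ord0 y = tuple_cons (y, z).
  apply: eq_from_tnth => k; rewrite tnth_mktuple.
  case: (unliftP ord0 k) => [k'|] ->; last by rewrite eqxx tnth_tuple_cons0.
  by rewrite !tnth_tuple_consS.
under eq_integral do rewrite E.
by under [leRHS]eq_integral do rewrite E.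
Qed.

End normal_vec_integral.

(** * Moments of the chi-square law *)

Section chi2.
Context {R : realType}.

Lemma nseq_tupleS (T : Type) d (x : T) :
  thead (nseq_tuple d.+1 x) = x /\ [tuple of behead (nseq_tuple d.+1 x)] = nseq_tuple d x.
Proof. by split => //; exact: val_inj. Qed.

Let mT n : measurable_fun [set: n.-tuple R] (fun z => \sum_(j < n) tnth z j ^+ 2).
Proof.
apply: measurable_sum => j; apply: measurable_funX; exact: measurable_tnth.
Qed.

Let T0 n (z : n.-tuple R) : 0 <= \sum_(j < n) tnth z j ^+ 2.
Proof. by apply: sumr_ge0 => j _; exact: sqr_ge0. Qed.

Let TS n (x : R) (z : n.-tuple R) :
  \sum_(j < n.+1) tnth (tuple_cons (x, z)) j ^+ 2 = x ^+ 2 + \sum_(j < n) tnth z j ^+ 2.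
Proof.
rewrite big_ord_recl tnth_tuple_cons0; congr (_ + _).
by apply: eq_bigr => j _; rewrite tnth_tuple_consS.
Qed.

Let m2 : (\int[normal_law 0%R 1%R]_x (x ^+ 2)%:E = 1%:E :> \bar R)%E.
Proof.
have := @normal_moment2 R 0 1 (oner_neq0 _); rewrite expr1n => <-.
by apply: eq_integral => x _; rewrite subr0.
Qed.

Let m4 : (\int[normal_law 0%R 1%R]_x (x ^+ 4)%:E = 3%:E :> \bar R)%E.
Proof.
have := @normal_moment4 R 0 1 (oner_neq0 _); rewrite expr1n mulr1 => <-.
by apply: eq_integral => x _; rewrite subr0.
Qed.

Let mX k : measurable_fun [set: R] (fun x : R => (x ^+ k)%:E).
Proof. by apply/measurable_EFinP; exact: measurable_funX. Qed.

Lemma integral_chi2 n :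
  (\int[normal_vec 1%R (nseq_tuple n (0%R : R))]_z (\sum_(j < n) tnth z j ^+ 2)%:E = n%:R%:E)%E.
Proof.
elim: n => [|n IH].
  rewrite integral_normal_vec0 ?big_ord0//.
  by apply/measurable_EFinP; exact: mT.
rewrite ge0_integral_normal_vecS; last 2 first.
- by apply/measurable_EFinP; exact: mT.
- by move=> z; rewrite lee_fin.
have [-> ->] := nseq_tupleS n (0%R : R).
transitivity (\int[normal_law 0%R 1%R]_x ((x ^+ 2)%:E + n%:R%:E) : \bar R)%E.
  apply: eq_integral => x _.
  under eq_integral do rewrite TS EFinD.
  rewrite ge0_integralD//; last 3 first.
  - by move=> z _; rewrite lee_fin sqr_ge0.
  - by move=> z _; rewrite lee_fin.
  - by apply/measurable_EFinP; exact: mT.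
  by rewrite IH integral_cst//= probability_setT mule1.
rewrite ge0_integralD//; try by move=> x _; rewrite lee_fin ?sqr_ge0.
by rewrite m2 integral_cst//= probability_setT mule1 -EFinD nat1r.
Qed.

Lemma integral_chi2_sqr n :
  (\int[normal_vec 1%R (nseq_tuple n (0%R : R))]_z ((\sum_(j < n) tnth z j ^+ 2) ^+ 2)%:E
   = (n%:R ^+ 2 + 2 * n%:R)%:E)%E.
Proof.
have mT2 k : measurable_fun [set: k.-tuple R] (fun z => ((\sum_(j < k) tnth z j ^+ 2) ^+ 2)%:E).
  by apply/measurable_EFinP; apply: measurable_funX; exact: mT.
elim: n => [|n IH].
  by rewrite integral_normal_vec0// big_ord0 !expr0n mulr0 addr0.
rewrite ge0_integral_normal_vecS//; last by move=> z; rewrite lee_fin sqr_ge0.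
have [-> ->] := nseq_tupleS n (0%R : R).
transitivity (\int[normal_law 0%R 1%R]_x ((x ^+ 4)%:E +
    ((2 * n%:R)%:E * (x ^+ 2)%:E + (n%:R ^+ 2 + 2 * n%:R)%:E)) : \bar R)%E.
  apply: eq_integral => x _.
  have E z : ((\sum_(j < n.+1) tnth (tuple_cons (x, z)) j ^+ 2) ^+ 2)%:E =
      ((x ^+ 4)%:E + ((2 * x ^+ 2)%:E * (\sum_(j < n) tnth z j ^+ 2)%:E +
       ((\sum_(j < n) tnth z j ^+ 2) ^+ 2)%:E))%E.
    by rewrite TS -EFinM -!EFinD; congr EFin; ring.
  under eq_integral do rewrite E.
  have x20 : 0 <= 2 * x ^+ 2 by rewrite mulr_ge0// sqr_ge0.
  have mT' : measurable_fun [set: n.-tuple R] (fun z => (\sum_(j < n) tnth z j ^+ 2)%:E).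
    by apply/measurable_EFinP; exact: mT.
  have mZ : measurable_fun [set: n.-tuple R]
      (fun z => (2 * x ^+ 2)%:E * (\sum_(j < n) tnth z j ^+ 2)%:E)%E.
    exact: measurable_funeM.
  have m12 := emeasurable_funD mZ (mT2 n).
  rewrite ge0_integralD//; first last.
  - by move=> z _; rewrite -EFinM -EFinD lee_fin addr_ge0 ?sqr_ge0// mulr_ge0.
  - by move=> z _; rewrite lee_fin exprn_even_ge0.
  rewrite ge0_integralD//; try by move=> z _; rewrite -?EFinM lee_fin ?sqr_ge0// mulr_ge0.
  rewrite ge0_integralZl//; last by move=> z _; rewrite lee_fin.
  rewrite IH integral_chi2 integral_cst//= probability_setT mule1 -!EFinM -!EFinD.
    by congr EFin; ring.
  exact: (mT2 n).
have n2 : 0 <= 2 * n%:R :> R by rewrite mulr_ge0.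
have mZ : measurable_fun [set: R] (fun x : R => (2 * n%:R)%:E * (x ^+ 2)%:E)%E.
  exact: measurable_funeM.
have mZ' := emeasurable_funD mZ (measurable_cst (n%:R ^+ 2 + 2 * n%:R)%:E).
rewrite ge0_integralD//; first last.
- move=> x _; rewrite -EFinM -EFinD lee_fin; apply: addr_ge0.
    by apply: mulr_ge0 => //; exact: sqr_ge0.
  by apply: addr_ge0 => //; exact: sqr_ge0.
- by move=> x _; rewrite lee_fin exprn_even_ge0.
rewrite ge0_integralD//; first last.
- by move=> x _; rewrite -EFinM lee_fin; apply: mulr_ge0 => //; exact: sqr_ge0.
rewrite ge0_integralZl//; last by move=> x _; rewrite lee_fin sqr_ge0.
rewrite m2 m4 integral_cst//= probability_setT mule1 -!EFinM -!EFinD.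
by congr EFin; rewrite -(natr1 n); ring.
Qed.

Lemma sum_sqr_ge0 n (sigma2 : R) (x : n.-tuple R) : 0 <= sigma2 -> 0 <= sum_sqr sigma2 x.
Proof. by move=> s0; rewrite /sum_sqr mulr_ge0. Qed.

Lemma ge0_integral_scaled_chi2 n (sigma2 : R) (f : R -> \bar R) :
  measurable_fun [set: R] f -> (forall s, 0 <= f s)%E ->
  (\int[scaled_chi2 n sigma2]_s f s =
   \int[normal_vec 1%R (nseq_tuple n (0%R : R))]_x f (sum_sqr sigma2 x))%E.
Proof. by move=> mf f0; rewrite ge0_integral_distribution. Qed.

(** Under the law of S biased by its size the mean of S is
    E[S^2] / E[S] = (n + 2) sigma^2, and a nonincreasing function of S is
    negatively correlated with S: this is what the divisor n + 2 is made for. *)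
Lemma chi2_nonincreasing_weight n (sigma2 K : R) (psi f : R -> R) :
  0 < sigma2 -> measurable_fun [set: R] psi -> (forall s : R, 0 <= psi s <= K) ->
  (forall s t : R, 0 < s -> s <= t -> psi t <= psi s) ->
  (forall s, f s = psi s * (s * (s - (n%:R + 2) * sigma2))) ->
  (\int[scaled_chi2 n sigma2]_s (EFin \o f)^\+ s <=
   \int[scaled_chi2 n sigma2]_s (EFin \o f)^\- s)%E.
Proof.
move=> s20 mpsi psiK psi_mono fE.
pose c := (n%:R + 2) * sigma2; have c0 : 0 < c by rewrite mulr_gt0// ltr_wpDl.
have mf : measurable_fun [set: R] f.
  rewrite (_ : f = fun s => psi s * (s * (s - c))); last exact/funext.
  by apply: measurable_funM => //; apply: measurable_funM => //; exact: measurable_funB.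
have mEf : measurable_fun [set: R] (EFin \o f) by exact/measurable_EFinP.
rewrite !ge0_integral_scaled_chi2//; [|exact: measurable_funeneg|exact: measurable_funepos].
set nu := normal_vec _ _; set S := sum_sqr sigma2.
have mS : measurable_fun [set: n.-tuple R] S by exact: measurable_sum_sqr.
have S0 x : 0 <= S x by exact/sum_sqr_ge0/ltW.
have ES : (\int[nu]_x (S x)%:E = (sigma2 * n%:R)%:E)%E.
  rewrite EFinM -integral_chi2 -ge0_integralZl//.
  - by apply/measurable_EFinP; exact: mT.
  - by move=> z _; rewrite lee_fin.
  - by rewrite lee_fin ltW.
have ES2 : (\int[nu]_x (S x ^+ 2)%:E = (sigma2 ^+ 2 * (n%:R ^+ 2 + 2 * n%:R))%:E)%E.
  rewrite EFinM -integral_chi2_sqr -ge0_integralZl//; last 3 first.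
  - by apply/measurable_EFinP; apply: measurable_funX; exact: mT.
  - by move=> z _; rewrite lee_fin sqr_ge0.
  - by rewrite lee_fin sqr_ge0.
  by apply: eq_integral => x _; rewrite -EFinM /S /sum_sqr exprMn.
have iS : nu.-integrable [set: n.-tuple R] (fun x => (S x)%:E).
  apply/integrableP; split; first by apply/measurable_EFinP; exact: mS.
  by under eq_integral do rewrite abse_EFin ger0_norm//; rewrite ES ltry.
have iS2 : nu.-integrable [set: n.-tuple R] (fun x => (S x ^+ 2)%:E).
  apply/integrableP; split; first by apply/measurable_EFinP; exact: measurable_funX.
  by under eq_integral do rewrite abse_EFin ger0_norm ?sqr_ge0//; rewrite ES2 ltry.
have iB : nu.-integrable [set: n.-tuple R] (fun x => (S x ^+ 2)%:E + c%:E * (S x)%:E)%E.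
  by apply: integrableD => //; exact: integrableZl.
have K0 : 0 <= K by have := psiK 1; lra.
have iF : nu.-integrable [set: n.-tuple R] (EFin \o f \o S).
  apply: (@le_integrable _ _ _ _ _ _ _ (fun x => K%:E * ((S x ^+ 2)%:E + c%:E * (S x)%:E))%E) => //.
  - by apply/measurable_EFinP; apply: (measurableT_comp mf).
  - move=> x _; have := S0 x; have := psiK (S x); rewrite /= fE -/c.
    move: (S x) (psi (S x)) => v u /andP[u0 uK] v0.
    rewrite lee_fin normrM [leRHS]ger0_norm; last by rewrite mulr_ge0// addr_ge0 ?sqr_ge0 ?mulr_ge0// ltW.
    apply: ler_pM => //; first by rewrite ger0_norm.
    by rewrite ler_norml; nra.
  - exact: integrableZl.
have iN : nu.-integrable [set: n.-tuple R] (EFin \o (fun x => - f (S x))).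
  by apply: eq_integrable (integrableN iF) => // x _ /=; rewrite EFinN.
(* [psi] lies above psi c before c and below it after c. *)
have dom : (0 <= \int[nu]_x (- f (S x))%:E)%E.
  apply: (@le_trans _ _ (\int[nu]_x ((psi c * c)%:E * (S x)%:E + (- psi c)%:E * (S x ^+ 2)%:E))%E).
    rewrite integralD//; [|exact: integrableZl|exact: integrableZl].
    rewrite !integralZl// ES ES2 -!EFinM -EFinD lee_fin le_eqVlt; apply/orP; left.
    by apply/eqP; rewrite /c; ring.
  apply: le_integral => //.
    by apply: integrableD => //; exact: integrableZl.
  move=> x _; rewrite -!EFinM -EFinD lee_fin fE -/c.
  have [Sx|] := ltP 0 (S x); last first.
    by move=> Sx; have -> : S x = 0 by [apply/eqP; rewrite eq_le Sx S0]; rewrite expr0n/= !(mulr0, mul0r, oppr0, addr0).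
  have h : (psi (S x) - psi c) * (S x - c) <= 0.
    have [xc|xc] := leP (S x) c.
      by rewrite mulr_ge0_le0// ?subr_ge0 ?psi_mono// subr_le0.
    by rewrite mulr_le0_ge0// ?subr_le0 ?psi_mono// ?subr_ge0// ltW.
  move: h Sx; move: (S x) (psi (S x)) (psi c) => v u w; nra.
have := (funeneg_le_funeposP measurableT iN).1 dom.
congr (_ <= _)%E; apply: eq_integral => x _.
- by rewrite funenegE !funeposE/= opprK.
- by rewrite funeposE !funenegE.
Qed.

End chi2.

(** * No estimator has maximal risk below d *)

Section likelihood_ratio.
Context {R : realType}.

(** The density of N(m, 1) with respect to N(0, 1). *)
Definition tilt (m x : R) : R := expR (m * x - m ^+ 2 / 2).

Lemma tilt_ge0 m x : 0 <= tilt m x. Proof. exact: expR_ge0. Qed.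

Lemma normal_pdf_tilt (m x : R) : normal_pdf m 1 x = normal_pdf 0 1 x * tilt m x.
Proof.
have n1 : (1 : R) != 0 by exact: oner_neq0.
rewrite !normal_pdfxE// -mulrA -expRD; congr (_ * expR _).
by rewrite expr1n; field.
Qed.

Lemma measurable_tilt2 d (T : measurableType d) (f g : T -> R) :
  measurable_fun [set: T] f -> measurable_fun [set: T] g ->
  measurable_fun [set: T] (fun x => tilt (f x) (g x)).
Proof.
move=> mf mg; apply: (measurableT_comp (@measurable_expR R)).
apply: measurable_funB; first exact: measurable_funM.
by apply: measurable_funM => //; exact: measurable_funX.
Qed.

Lemma ge0_integral_normal_law_tilt (m : R) (f : R -> \bar R) :
  measurable_fun [set: R] f -> (forall x, 0 <= f x)%E ->
  (\int[normal_law m 1%R]_x f x = \int[normal_law 0%R 1%R]_x (f x * (tilt m x)%:E))%E.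
Proof.
move=> mf f0; have n1 : (1 : R) != 0 by exact: oner_neq0.
have mt : measurable_fun [set: R] (fun x => (tilt m x)%:E).
  by apply/measurable_EFinP; exact: measurable_tilt2.
have mft : measurable_fun [set: R] (fun x => f x * (tilt m x)%:E)%E.
  exact: emeasurable_funM.
have ft0 x : (0 <= f x * (tilt m x)%:E)%E by rewrite mule_ge0// lee_fin tilt_ge0.
rewrite [LHS](ge0_integral_normal_law _ n1 mf f0) [RHS](ge0_integral_normal_law _ n1 mft ft0).
by apply: eq_integral => x _; rewrite normal_pdf_tilt mulrC EFinM muleA.
Qed.

Definition likelihood d (theta z : d.-tuple R) : R :=
  \prod_(i < d) tilt (tnth theta i) (tnth z i).

Lemma likelihood_ge0 d (theta z : d.-tuple R) : 0 <= likelihood theta z.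
Proof. by apply: prodr_ge0 => i _; exact: tilt_ge0. Qed.

Lemma measurable_likelihood2 d d' (T : measurableType d') (f g : T -> d.-tuple R) :
  measurable_fun [set: T] f -> measurable_fun [set: T] g ->
  measurable_fun [set: T] (fun x => likelihood (f x) (g x)).
Proof.
move=> mf mg; apply: measurable_prod => i _; apply: measurable_tilt2.
  by apply: (measurableT_comp (measurable_tnth i) mf).
by apply: (measurableT_comp (measurable_tnth i) mg).
Qed.

Lemma likelihoodS d (theta : d.+1.-tuple R) x (z : d.-tuple R) :
  likelihood theta (tuple_cons (x, z)) =
  tilt (thead theta) x * likelihood [tuple of behead theta] z.
Proof.
rewrite /likelihood big_ord_recl tnth_tuple_cons0; congr (_ * _).
by apply: eq_bigr => i _; rewrite tnth_tuple_consS tnth_beheadS.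
Qed.

Lemma ge0_integral_normal_vec_likelihood d (theta : d.-tuple R) (f : d.-tuple R -> \bar R) :
  measurable_fun [set: d.-tuple R] f -> (forall z, 0 <= f z)%E ->
  (\int[normal_vec 1%R theta]_z f z =
   \int[normal_vec 1%R (nseq_tuple d 0%R)]_z (f z * (likelihood theta z)%:E))%E.
Proof.
elim: d theta f => [|d IH] theta f mf f0.
  have mfl : measurable_fun [set: 0.-tuple R] (fun z => f z * (likelihood theta z)%:E)%E.
    by apply: emeasurable_funM => //; apply/measurable_EFinP; exact: measurable_likelihood2.
  by rewrite !integral_normal_vec0// /likelihood big_ord0 mule1.
have ml : measurable_fun [set: d.+1.-tuple R] (fun z => (likelihood theta z)%:E).
  by apply/measurable_EFinP; exact: measurable_likelihood2.
have mfl : measurable_fun [set: d.+1.-tuple R] (fun z => f z * (likelihood theta z)%:E)%E.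
  exact: emeasurable_funM.
have fl0 z : (0 <= f z * (likelihood theta z)%:E)%E by rewrite mule_ge0// lee_fin likelihood_ge0.
rewrite [LHS](ge0_integral_normal_vecS _ _ mf f0) [RHS](ge0_integral_normal_vecS _ _ mfl fl0).
have [-> ->] := nseq_tupleS d (0%R : R).
set th := [tuple of behead theta]; set z0 := nseq_tuple d _.
have mc x : measurable_fun [set: d.-tuple R] (fun z => f (tuple_cons (x, z))).
  have mpf : measurable_fun [set: R * d.-tuple R] (f \o @tuple_cons R d).
    by apply: (measurableT_comp mf); exact: measurable_tuple_cons.
  by apply: (measurableT_comp mpf); exact: pair1_measurable.
have ml' : measurable_fun [set: d.-tuple R] (fun z => (likelihood th z)%:E).
  by apply/measurable_EFinP; exact: measurable_likelihood2.
have E x : (\int[normal_vec 1%R th]_z f (tuple_cons (x, z)) =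
    \int[normal_vec 1%R z0]_z (f (tuple_cons (x, z)) * (likelihood th z)%:E))%E.
  by apply: IH => //; exact: mc.
pose F (xz : R * d.-tuple R) := (f (tuple_cons xz) * (likelihood th xz.2)%:E)%E.
have mF : measurable_fun [set: R * d.-tuple R] F.
  apply: emeasurable_funM; first by apply: (measurableT_comp mf); exact: measurable_tuple_cons.
  by apply/measurable_EFinP; apply: measurable_likelihood2 => //; exact: measurable_snd.
have F0 xz : (0 <= F xz)%E by rewrite mule_ge0// lee_fin likelihood_ge0.
pose J x := (\int[normal_vec 1%R z0]_z F (x, z))%E.
have mJ : measurable_fun [set: R] J.
  exact: (@measurable_fun_fubini_tonelli_F _ _ _ _ R (normal_vec 1%R z0) F mF F0).
have J0 x : (0 <= J x)%E by apply: integral_ge0.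
transitivity (\int[normal_law (thead theta) 1%R]_x J x)%E.
  by apply: eq_integral => x _; exact: E.
rewrite [LHS](ge0_integral_normal_law_tilt _ mJ J0).
apply: eq_integral => x _.
have mFx : measurable_fun [set: d.-tuple R] (fun z => F (x, z)).
  by apply: (measurableT_comp mF); exact: pair1_measurable.
have t0 : (0 <= (tilt (thead theta) x)%:E)%E by rewrite lee_fin tilt_ge0.
rewrite /J -ge0_integralZr//.
apply: eq_integral => z _.
by rewrite /F likelihoodS EFinM -muleA [X in (_ * X)%E]muleC.
Qed.

End likelihood_ratio.

Lemma complete_square (R : realType) (u t z : R) : 0 < u ->
  t * z - t ^+ 2 / 2 - t ^+ 2 / (u * 2) =
  u / (1 + u) * z ^+ 2 / 2 - (t - u / (1 + u) * z) ^+ 2 / (u / (1 + u) * 2).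
Proof.
move=> u0; have u1 : 0 < 1 + u by rewrite addr_gt0.
by field; rewrite !gt_eqF.
Qed.

Section bayes.
Context {R : realType}.
Variable tau : R.
Hypothesis tau0 : 0 < tau.

Let kappa := tau ^+ 2 / (1 + tau ^+ 2).

Let t2 : 0 < tau ^+ 2. Proof. by rewrite exprn_gt0. Qed.
Let t21 : 0 < 1 + tau ^+ 2. Proof. by rewrite addr_gt0. Qed.
Let kappa0 : 0 < kappa. Proof. by rewrite divr_gt0. Qed.
Let tauN0 : tau != 0. Proof. by rewrite gt_eqF. Qed.
Let sk0 : Num.sqrt kappa != 0. Proof. by rewrite gt_eqF// sqrtr_gt0. Qed.

Let M (z : R) := normal_peak tau / normal_peak (Num.sqrt kappa) * expR (kappa * z ^+ 2 / 2).

Let M0 z : 0 < M z.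
Proof. by rewrite mulr_gt0 ?expR_gt0// divr_gt0// normal_peak_gt0. Qed.

(* The posterior law of a normal mean with prior N(0, tau^2), given one unit
   variance observation z, is N(kappa z, kappa), and M z is the marginal density
   of z relative to N(0, 1). *)
Let tilt_prior z t : tilt t z * normal_pdf 0 tau t = M z * normal_pdf (kappa * z) (Num.sqrt kappa) t.
Proof.
have pk := normal_peak_gt0 sk0.
rewrite !normal_pdfxE// /M sqr_sqrtr ?(ltW kappa0)//.
have -> : normal_peak tau / normal_peak (Num.sqrt kappa) * expR (kappa * z ^+ 2 / 2) *
    (normal_peak (Num.sqrt kappa) * expR (- (t - kappa * z) ^+ 2 / (kappa *+ 2))) =
  normal_peak tau * (expR (kappa * z ^+ 2 / 2) * expR (- (t - kappa * z) ^+ 2 / (kappa *+ 2))).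
  by field; rewrite gt_eqF.
rewrite -expRD /tilt mulrCA -expRD; congr (_ * expR _).
rewrite subr0 -[tau ^+ 2 *+ 2]mulr_natr -[kappa *+ 2]mulr_natr !mulNr.
exact: complete_square.
Qed.

Let integral_tilt_prior z (f : R -> R) : measurable_fun [set: R] f -> (forall t, 0 <= f t) ->
  (\int[normal_law 0%R tau]_t (f t * tilt t z)%:E =
   (M z)%:E * \int[normal_law (kappa * z) (Num.sqrt kappa)]_t (f t)%:E)%E.
Proof.
move=> mf f0; have mt : measurable_fun [set: R] (fun t => tilt t z) by exact: measurable_tilt2.
have mft : measurable_fun [set: R] (fun t => f t * tilt t z) by exact: measurable_funM.
rewrite [LHS]integral_normal_law// [in RHS]integral_normal_law//.
rewrite -ge0_integralZl//; last 3 first.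
- by apply/measurable_EFinP; apply: measurable_funM => //; exact: measurable_normal_pdf.
- by move=> x _; rewrite lee_fin mulr_ge0// normal_pdf_ge0.
- by rewrite lee_fin ltW.
by apply: eq_integral => t _; rewrite -EFinM -mulrA tilt_prior mulrCA.
Qed.

Let integral_tilt z : (\int[normal_law 0%R tau]_t (tilt t z)%:E = (M z)%:E)%E.
Proof.
have := @integral_tilt_prior z (fun=> 1) (measurable_cst _) (fun=> ler01).
rewrite [X in (_ = _ * X)%E](_ : _ = 1%E); last first.
  by rewrite integral_cst//= mul1e probability_setT.
rewrite mule1 => <-.
by apply: eq_integral => t _; rewrite mul1r.
Qed.

Let integral_sqr_tilt a z : (\int[normal_law 0%R tau]_t ((a - t) ^+ 2 * tilt t z)%:E =
  (M z * (kappa + (a - kappa * z) ^+ 2))%:E)%E.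
Proof.
rewrite integral_tilt_prior; last 2 first.
- by apply: measurable_funX; exact: measurable_funB.
- by move=> t; exact: sqr_ge0.
by rewrite normal_second_moment// sqr_sqrtr ?(ltW kappa0)// EFinM.
Qed.

Lemma integral_likelihood_prior d (z : d.-tuple R) :
  (\int[normal_vec tau (nseq_tuple d 0%R)]_theta (likelihood theta z)%:E =
   (\prod_(i < d) M (tnth z i))%:E)%E.
Proof.
apply: (@integral_normal_vec_prod _ tau d (nseq_tuple d 0) (fun i t => tilt t (tnth z i))).
- by move=> i; exact: measurable_tilt2.
- by move=> i x; exact: tilt_ge0.
- by move=> i; rewrite tnth_nseq integral_tilt.
Qed.

(** The posterior variance of each coordinate is [kappa], so that no action [a]
    has posterior expected loss below [d * kappa]. *)
Lemma posterior_loss_ge d (a z : d.-tuple R) :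
  ((d%:R * kappa)%:E * \int[normal_vec tau (nseq_tuple d 0%R)]_theta (likelihood theta z)%:E <=
   \int[normal_vec tau (nseq_tuple d 0%R)]_theta (loss a theta 1 * likelihood theta z)%:E)%E.
Proof.
rewrite integral_likelihood_prior.
have ml : measurable_fun [set: d.-tuple R] (fun theta => likelihood theta z).
  exact: measurable_likelihood2.
have mi i : measurable_fun [set: d.-tuple R]
    (fun theta => ((tnth a i - tnth theta i) ^+ 2 * likelihood theta z)%:E).
  apply/measurable_EFinP; apply: measurable_funM => //.
  apply: measurable_funX; apply: measurable_funB => //; exact: measurable_tnth.
under [leRHS]eq_integral => theta _.
  rewrite /loss (eq_bigr (fun i => (tnth a i - tnth theta i) ^+ 2)); last by move=> i _; rewrite divr1.
  rewrite mulr_suml -sumEFin.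
  over.
rewrite ge0_integral_sum//; last first.
  by move=> i theta _; rewrite lee_fin mulr_ge0 ?sqr_ge0// likelihood_ge0.
have -> : ((d%:R * kappa)%:E * (\prod_(i < d) M (tnth z i))%:E =
    \sum_(i < d) (kappa * \prod_(j < d) M (tnth z j))%:E)%E.
  by rewrite sumEFin sumr_const card_ord -EFinM; congr EFin; rewrite -[RHS]mulr_natl [RHS]mulrA.
apply: lee_sum => i _.
pose f (j : 'I_d) t := (if j == i then (tnth a i - t) ^+ 2 else 1) * tilt t (tnth z j).
pose c (j : 'I_d) := M (tnth z j) * (if j == i then kappa + (tnth a i - kappa * tnth z i) ^+ 2 else 1).
have E theta : (tnth a i - tnth theta i) ^+ 2 * likelihood theta z = \prod_j f j (tnth theta j).
  by rewrite /f big_split/= -big_mkcond/= big_pred1_eq.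
under eq_integral do rewrite E.
rewrite (@integral_normal_vec_prod _ tau d (nseq_tuple d 0) f c).
- rewrite lee_fin /c [leRHS]big_split/= -big_mkcond/= big_pred1_eq [leLHS]mulrC.
  rewrite ler_wpM2l//; last by rewrite lerDl sqr_ge0.
  by apply: prodr_ge0 => j _; exact/ltW.
- move=> j; apply: measurable_funM; last exact: measurable_tilt2.
  by case: (j == i) => //; apply: measurable_funX; exact: measurable_funB.
- by move=> j t; rewrite mulr_ge0 ?tilt_ge0//; case: (j == i) => //; exact: sqr_ge0.
- move=> j; rewrite tnth_nseq /f /c; case: eqP => [->|_].
    by rewrite integral_sqr_tilt.
  by under eq_integral do rewrite mul1r; rewrite integral_tilt mulr1.
Qed.

End bayes.

Section minimax_lower_bound.
Context {R : realType}.
Variables (d n : nat) (delta : d.-tuple R * R -> d.-tuple R).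
Hypothesis mdelta : estimator delta.

Lemma loss_ge0 (a theta : d.-tuple R) (sigma2 : R) : 0 <= sigma2 -> 0 <= loss a theta sigma2.
Proof. by move=> s0; apply: sumr_ge0 => i _; rewrite divr_ge0// sqr_ge0. Qed.

Lemma measurable_loss2 d' (T : measurableType d') (f g : T -> d.-tuple R) (sigma2 : R) :
  measurable_fun [set: T] f -> measurable_fun [set: T] g ->
  measurable_fun [set: T] (fun x => loss (f x) (g x) sigma2).
Proof.
move=> mf mg; apply: measurable_sum => i; apply: measurable_funM => //.
apply: measurable_funX; apply: measurable_funB.
  exact: (measurableT_comp (measurable_tnth i) mf).
exact: (measurableT_comp (measurable_tnth i) mg).
Qed.

Let std_law := sample_law n (nseq_tuple d (0 : R)) 1.
Let F (x : d.-tuple R * (d.-tuple R * R)) := (loss (delta x.2) x.1 1 * likelihood x.1 x.2.1)%:E.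

Let mlik : measurable_fun [set: d.-tuple R * (d.-tuple R * R)]
  (fun x => (likelihood x.1 x.2.1)%:E).
Proof.
apply/measurable_EFinP; apply: measurable_likelihood2; first exact: measurable_fst.
by apply: (measurableT_comp measurable_fst); exact: measurable_snd.
Qed.

Let mF : measurable_fun [set: d.-tuple R * (d.-tuple R * R)] F.
Proof.
apply/measurable_EFinP; apply: measurable_funM; last exact/measurable_EFinP.
apply: measurable_loss2; last exact: measurable_fst.
by apply: (measurableT_comp mdelta); exact: measurable_snd.
Qed.

Let F0 x : (0 <= F x)%E.
Proof. by rewrite lee_fin mulr_ge0// ?likelihood_ge0// loss_ge0. Qed.

Let integral_sample_law theta (f : d.-tuple R * R -> \bar R) :
  measurable_fun [set: d.-tuple R * R] f -> (forall zs, 0 <= f zs)%E ->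
  (\int[sample_law n theta 1%R]_zs f zs =
   \int[std_law]_zs (f zs * (likelihood theta zs.1)%:E))%E.
Proof.
move=> mf f0.
have ml : measurable_fun [set: d.-tuple R * R] (fun zs => (likelihood theta zs.1)%:E).
  by apply/measurable_EFinP; apply: measurable_likelihood2 => //; exact: measurable_fst.
have mfl : measurable_fun [set: d.-tuple R * R] (fun zs => f zs * (likelihood theta zs.1)%:E)%E.
  exact: emeasurable_funM.
have fl0 zs : (0 <= f zs * (likelihood theta zs.1)%:E)%E by rewrite mule_ge0// lee_fin likelihood_ge0.
rewrite /std_law /sample_law sqrtr1.
rewrite [LHS](fubini_tonelli2 _ mf f0) [RHS](fubini_tonelli2 _ mfl fl0).
apply: eq_integral => s _; rewrite /fubini_G.
apply: (@ge0_integral_normal_vec_likelihood _ _ theta (fun z => f (z, s))) => //.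
by apply: (measurableT_comp mf); exact: pair2_measurable.
Qed.

Let riskE theta : risk n delta theta 1 = (\int[std_law]_zs F (theta, zs))%E.
Proof.
rewrite /risk unlock (integral_sample_law theta)//.
- by apply/measurable_EFinP; exact: measurable_loss2.
- by move=> zs; rewrite lee_fin loss_ge0.
Qed.

Let bayes_risk_le tau : 0 < tau ->
  ((d%:R * (tau ^+ 2 / (1 + tau ^+ 2)))%:E <= sup_risk n delta)%E.
Proof.
move=> tau0; set k := d%:R * _.
have k0 : 0 <= k by rewrite mulr_ge0// divr_ge0 ?addr_ge0 ?sqr_ge0.
pose prior : probability (d.-tuple R) R := normal_vec tau (nseq_tuple d (0 : R)).
pose risk1 theta := (\int[std_law]_zs F (theta, zs))%E.
have mrisk : measurable_fun [set: d.-tuple R] risk1.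
  exact: (@measurable_fun_fubini_tonelli_F _ _ _ _ R std_law F mF F0).
have risk0 theta : (0 <= risk1 theta)%E by apply: integral_ge0.
pose L (x : d.-tuple R * (d.-tuple R * R)) := (likelihood x.1 x.2.1)%:E.
have L0 x : (0 <= L x)%E by rewrite lee_fin likelihood_ge0.
have total theta : (\int[std_law]_zs L (theta, zs) = 1)%E.
  have := @integral_sample_law theta (fun=> 1%E) (measurable_cst _) (fun=> lee01).
  rewrite integral_cst//= mul1e probability_setT => ->.
  by apply: eq_integral => zs _; rewrite mul1e.
have mass : (\int[std_law]_zs \int[prior]_theta L (theta, zs) = 1)%E.
  rewrite -(fubini_tonelli L mlik L0).
  under eq_integral do rewrite total.
  by rewrite integral_cst//= mul1e probability_setT.
have mass_m : measurable_fun [set: d.-tuple R * R] (fun zs => \int[prior]_theta L (theta, zs))%E.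
  exact: (@measurable_fun_fubini_tonelli_G _ _ _ _ R prior L mlik L0).
apply: (@le_trans _ _ (\int[prior]_theta risk1 theta)%E); last first.
  apply: (@le_trans _ _ (\int[prior]_theta sup_risk n delta)%E); last first.
    by rewrite integral_cst//= probability_setT mule1.
  apply: ge0_le_integral => //.
  - move=> theta _; rewrite /risk1 -riskE; apply: ereal_sup_ubound.
    by exists theta; exists 1.
rewrite (fubini_tonelli F mF F0).
apply: (@le_trans _ _ (\int[std_law]_zs (k%:E * \int[prior]_theta L (theta, zs)))%E).
  by rewrite ge0_integralZl//; [rewrite mass mule1|move=> zs _; apply: integral_ge0].
apply: ge0_le_integral => //.
- by move=> zs _; rewrite mule_ge0// ?lee_fin//; apply: integral_ge0.
- exact: measurable_funeM.
- exact: (@measurable_fun_fubini_tonelli_G _ _ _ _ R prior F mF F0).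
- by move=> zs _; exact: (posterior_loss_ge tau0 (delta zs) zs.1).
Qed.

(** The risk d of the estimator z is the limit of the Bayes risks of the normal
    priors N(0, tau^2 I) as tau grows. *)
Lemma sup_risk_ge : (d%:R%:E <= sup_risk n delta)%E.
Proof.
have H k := bayes_risk_le (ltr0Sn R k).
have d0 k : 0 <= d%:R * (k.+1%:R ^+ 2 / (1 + k.+1%:R ^+ 2)) :> R.
  by rewrite mulr_ge0// divr_ge0 ?addr_ge0 ?sqr_ge0.
case: (sup_risk n delta) H => [r| |] H; [|by rewrite leey|by have := H 0%N; rewrite leeNy_eq].
rewrite lee_fin -subr_ge0; apply: (@le_harmonic_ge0 _ _ d%:R) => k.
have := H k; rewrite lee_fin.
set t : R := k.+1%:R; have t1 : 1 <= t by rewrite /t ler1n.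
have -> : t ^+ 2 / (1 + t ^+ 2) = 1 - (1 + t ^+ 2)^-1.
  by field; rewrite gt_eqF// addr_gt0// exprn_gt0//; lra.
have : (1 + t ^+ 2)^-1 <= t^-1.
  by rewrite lef_pV2 ?posrE//; nra.
have : 0 <= d%:R :> R by [].
move: (_^-1) (_^-1) (d%:R) => a b D; nra.
Qed.

End minimax_lower_bound.

Lemma integrable_scaled_chi2 (R : realType) n (sigma2 : R) : 0 <= sigma2 ->
  (scaled_chi2 n sigma2).-integrable [set: R] (EFin \o (fun s => `|s| + s ^+ 2)).
Proof.
move=> s0.
have m1 : measurable_fun [set: R] (fun s : R => `|s| + s ^+ 2).
  by apply: measurable_funD; [exact: normr_measurable|exact: measurable_funX].
have mE : measurable_fun [set: R] (fun s : R => (`|s| + s ^+ 2)%:E) by exact/measurable_EFinP.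
apply/integrableP; split => //.
under eq_integral do rewrite /= ger0_norm ?addr_ge0 ?sqr_ge0//.
rewrite ge0_integral_scaled_chi2//; last by move=> s; rewrite lee_fin addr_ge0 ?sqr_ge0.
pose T (x : n.-tuple R) := \sum_(j < n) tnth x j ^+ 2.
have T0 x : 0 <= T x by apply: sumr_ge0 => j _; exact: sqr_ge0.
have mT : measurable_fun [set: n.-tuple R] T.
  by apply: measurable_sum => j; apply: measurable_funX; exact: measurable_tnth.
have mT1 : measurable_fun [set: n.-tuple R] (fun x => (T x)%:E) by exact/measurable_EFinP.
have mT2 : measurable_fun [set: n.-tuple R] (fun x => (T x ^+ 2)%:E).
  by apply/measurable_EFinP; exact: measurable_funX.
have E x : (`|sum_sqr sigma2 x| + sum_sqr sigma2 x ^+ 2)%:E =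
    (sigma2%:E * (T x)%:E + (sigma2 ^+ 2)%:E * (T x ^+ 2)%:E)%E.
  by rewrite ger0_norm ?sum_sqr_ge0// /sum_sqr exprMn -!EFinM -EFinD.
under eq_integral do rewrite E.
rewrite ge0_integralD//; first last.
- exact: measurable_funeM.
- by move=> x _; rewrite -EFinM lee_fin mulr_ge0 ?sqr_ge0.
- exact: measurable_funeM.
- by move=> x _; rewrite -EFinM lee_fin mulr_ge0.
rewrite ge0_integralZl//; [|by move=> x _; rewrite lee_fin].
rewrite ge0_integralZl//; [|by move=> x _; rewrite lee_fin sqr_ge0|by rewrite lee_fin sqr_ge0].
by rewrite integral_chi2 integral_chi2_sqr -!EFinM -EFinD ltry.
Qed.

(** * The pointwise inequality *)

Section power_sums.
Context {R : realType}.

Lemma chebyshev_sum_le d (a b : 'I_d -> R) :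
  (forall i j, (a i - a j) * (b i - b j) <= 0) ->
  d%:R * (\sum_i a i * b i) <= (\sum_i a i) * (\sum_i b i).
Proof.
move=> ab; have : \sum_i \sum_j (a i - a j) * (b i - b j) <= 0.
  by apply: sumr_le0 => i _; apply: sumr_le0 => j _; exact: ab.
have -> : \sum_i \sum_j (a i - a j) * (b i - b j) =
    2 * (d%:R * (\sum_i a i * b i)) - 2 * ((\sum_i a i) * (\sum_i b i)).
  transitivity (\sum_i (d%:R * (a i * b i) + \sum_j a j * b j - a i * (\sum_j b j) - (\sum_j a j) * b i)).
    apply: eq_bigr => i _.
    transitivity (\sum_j (a i * b i + a j * b j - a i * b j - a j * b i)).
      by apply: eq_bigr => j _; ring.
    by rewrite !sumrB big_split/= sumr_const card_ord mulr_natl mulr_sumr mulr_suml.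
  rewrite !sumrB big_split/= -!mulr_sumr -mulr_suml sumr_const card_ord -[X in _ + X - _ - _]mulr_natl.
  ring.
lra.
Qed.

Lemma le_powR (s t q : R) : 0 <= q -> 0 <= s -> s <= t -> s `^ q <= t `^ q.
Proof.
move=> q0 s0 st; have t0 := le_trans s0 st.
by apply: (@ge0_ler_powR R q q0 s t).
Qed.

Lemma pos_powRD (x u v : R) : 0 < x -> x `^ (u + v) = x `^ u * x `^ v.
Proof. by move=> x0; rewrite powRD ?(gt_eqF x0) ?implybT. Qed.

Lemma pos_powRB (x u v : R) : 0 < x -> x `^ (u - v) = x `^ u / x `^ v.
Proof. by move=> x0; rewrite pos_powRD// powRN. Qed.

Lemma powR_le1 (r q : R) : 0 < r <= 1 -> 0 <= q -> r `^ q <= 1.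
Proof. by move=> r01 q0; rewrite -(powRr0 r); apply: ger_powR. Qed.

Lemma powR_anti_mono (s t q : R) : 0 < s -> s <= t -> q <= 0 -> t `^ q <= s `^ q.
Proof.
move=> s0 st q0; have t0 : 0 < t by exact: lt_le_trans st.
have E u : u `^ q = (u `^ (- q))^-1 by rewrite -powRN opprK.
rewrite !{}E lef_pV2 ?posrE ?powR_gt0//.
by apply: le_powR; rewrite ?oppr_ge0// ltW.
Qed.

Lemma powR_le_tangent (u s : R) : 0 <= u -> 0 < s -> s < 1 -> u `^ s <= 1 + s * (u - 1).
Proof.
move=> u0 s0 s1; have s1' : 0 < 1 - s by rewrite subr_gt0.
have sn : s != 0 by rewrite gt_eqF. have sn1 : 1 - s != 0 by rewrite gt_eqF.
have := @conjugate_powR R (u `^ s) 1 s^-1 (1 - s)^-1 (powR_ge0 _ _) ler01.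
rewrite -powRrM divff// powRr1// powR1 mulr1 !invrK !invr_gt0.
have -> : s + (1 - s) = 1 by ring.
move=> /(_ s0 s1' erefl); lra.
Qed.

(** On the unit sphere of l^p, the sum of the q-th powers is at most 1 if
    p <= q, since each coordinate is at most 1, and at most d^(1 - q/p) if q < p,
    by concavity of x^(q/p). This is where the factor min(1, d^((2-p-alpha)/p))
    of the bound on phi comes from, with q = 2 - alpha. *)
Lemma lp_unit_sphere_bound d (r : 'I_d -> R) (p q : R) :
  0 < p -> 0 < q -> (forall i, 0 < r i <= 1) -> \sum_i r i `^ p = 1 ->
  Num.min 1 (d%:R `^ ((q - p) / p)) * \sum_i r i `^ q <= 1.
Proof.
move=> p0 q0 r01 rp; have Q0 : 0 <= \sum_i r i `^ q by apply: sumr_ge0 => i _; exact: powR_ge0.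
have d0 : 0 <= d%:R :> R by [].
have [pq|qp] := leP p q.
  apply: (@le_trans _ _ (1 * \sum_i r i `^ q)); first by rewrite ler_wpM2r// ge_min lexx.
  by rewrite mul1r -rp; apply: ler_sum => i _; exact: ger_powR.
have d1 : (0 < d)%N.
  rewrite lt0n; apply/eqP => dE; move: rp; case: _ / (esym dE) (r) => r'.
  by rewrite big_ord0 => /esym/eqP; rewrite oner_eq0.
have dgt0 : 0 < d%:R :> R by rewrite ltr0n.
apply: (@le_trans _ _ (d%:R `^ ((q - p) / p) * \sum_i r i `^ q)).
  by rewrite ler_wpM2r// ge_min lexx orbT.
pose s := q / p.
have s0 : 0 < s by rewrite divr_gt0.
have s1 : s < 1 by rewrite ltr_pdivrMr// mul1r.
have -> : (q - p) / p = s - 1 by rewrite /s mulrBl divff// gt_eqF.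
have E : \sum_i (d%:R * r i `^ p) `^ s = d%:R `^ s * \sum_i r i `^ q.
  rewrite mulr_sumr; apply: eq_bigr => i _.
  rewrite powRM ?powR_ge0// -powRrM; congr (_ * _ `^ _).
  by rewrite /s mulrC divfK// gt_eqF.
have : \sum_i (d%:R * r i `^ p) `^ s <= d%:R.
  apply: (@le_trans _ _ (\sum_i (1 + s * (d%:R * r i `^ p - 1)))).
    by apply: ler_sum => i _; apply: powR_le_tangent => //; rewrite mulr_ge0 ?powR_ge0.
  rewrite big_split/= sumr_const card_ord -mulr_sumr sumrB -mulr_sumr rp sumr_const card_ord.
  by rewrite mulr1 subrr mulr0 addr0.
rewrite E pos_powRB// powRr1// => h.
by rewrite mulrAC ler_pdivrMr// mul1r.
Qed.

End power_sums.

Section shrinkage_factor.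
Context {R : realType}.
Implicit Types (p alpha N x y : R).

(** The i-th component of the shrinkage direction is [shrink alpha N z_i] and
    its derivative along the i-th axis is [dshrink p alpha N z_i], where [N] is
    the l^p norm of z. *)
Definition shrink alpha N x := x / (N `^ (2 - alpha) * `|x| `^ alpha).

Definition dshrink p alpha N x :=
  (1 - alpha) * (`|x| `^ (- alpha) * N `^ (alpha - 2)) -
  (2 - alpha) * (`|x| `^ (p - alpha) * N `^ (alpha - 2 - p)).

Lemma shrink_normalized alpha (r N x : R) : 0 < r -> 0 < N -> `|x| = r * N ->
  shrink alpha N x ^+ 2 = N `^ (- 2) * (r `^ (- alpha) * r `^ (2 - alpha)).
Proof.
move=> r0 N0 xE.
have x0 : 0 < `|x| by rewrite xE mulr_gt0.
rewrite /shrink -real_normK ?num_real// normrM normfV normrM.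
rewrite (ger0_norm (powR_ge0 _ _)) (ger0_norm (powR_ge0 _ _)) xE powRM ?(ltW r0) ?(ltW N0)//.
have -> : N `^ (- 2) = N ^- 2 by rewrite -powR_invn ?(ltW N0)// .
rewrite !powRN !pos_powRB//.
rewrite !powR_mulrn ?(ltW r0) ?(ltW N0)//.
have := powR_gt0 alpha r0; have := powR_gt0 alpha N0.
move: (_ `^ _) (_ `^ _) => u v u0 v0.
by field; rewrite !gt_eqF.
Qed.

Lemma dshrink_normalized p alpha (r N x : R) : 0 < r -> 0 < N -> `|x| = r * N ->
  dshrink p alpha N x =
  N `^ (- 2) * ((1 - alpha) * r `^ (- alpha) - (2 - alpha) * (r `^ (- alpha) * r `^ p)).
Proof.
move=> r0 N0 xE; rewrite /dshrink xE !powRM ?(ltW r0) ?(ltW N0)//.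
have NE u v : N `^ u * N `^ v = N `^ (u + v) by rewrite pos_powRD.
have rE u v : r `^ u * r `^ v = r `^ (u + v) by rewrite pos_powRD.
rewrite rE.
rewrite -(mulrA (r `^ (- alpha))) NE -(mulrA (r `^ (p - alpha))) NE.
have -> : - alpha + (alpha - 2) = - 2 by ring.
have -> : p - alpha + (alpha - 2 - p) = - 2 by ring.
have -> : - alpha + p = p - alpha by ring.
ring.
Qed.

Lemma shrink_sqr_le alpha N x : alpha < 1 -> 0 < `|x| <= N ->
  shrink alpha N x ^+ 2 <= `|x| `^ (- alpha) * N `^ (alpha - 2).
Proof.
move=> a1 /andP[x0 xN]; have N0 : 0 < N by exact: lt_le_trans xN.
have r0 : 0 < `|x| / N by rewrite divr_gt0.
have xE : `|x| = (`|x| / N) * N by rewrite divfK// gt_eqF.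
rewrite (shrink_normalized alpha r0 N0 xE).
have -> : `|x| `^ (- alpha) * N `^ (alpha - 2) = N `^ (- 2) * (`|x| / N) `^ (- alpha).
  rewrite {1}xE powRM ?(ltW r0) ?(ltW N0)// -mulrA -pos_powRD//.
  by rewrite mulrC; congr (_ `^ _ * _); ring.
rewrite ler_wpM2l ?powR_ge0// ler_piMr ?powR_ge0//.
apply: powR_le1; last by lra.
by rewrite r0/= ler_pdivrMr// mul1r.
Qed.

Lemma dshrink_le p alpha N x : 0 < p -> 0 <= alpha -> alpha < 1 -> 0 < `|x| <= N ->
  `|dshrink p alpha N x| <= 3 * (`|x| `^ (- alpha) * N `^ (alpha - 2)).
Proof.
move=> p0 a0 a1 /andP[x0 xN]; have N0 : 0 < N by exact: lt_le_trans xN.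
rewrite /dshrink.
have -> : `|x| `^ (p - alpha) * N `^ (alpha - 2 - p) =
    `|x| `^ (- alpha) * N `^ (alpha - 2) * (`|x| / N) `^ p.
  have -> : `|x| `^ (p - alpha) = `|x| `^ (- alpha) * `|x| `^ p.
    by rewrite -pos_powRD//; congr (_ `^ _); ring.
  have -> : N `^ (alpha - 2 - p) = N `^ (alpha - 2) * N `^ (- p) by rewrite -pos_powRD.
  have -> : (`|x| / N) `^ p = `|x| `^ p * N `^ (- p).
    by rewrite powRM ?invr_ge0 ?(ltW N0)// -(powR_inv1 (ltW N0)) -powRrM mulN1r.
  ring.
have w0 : 0 <= `|x| `^ (- alpha) * N `^ (alpha - 2) by rewrite mulr_ge0 ?powR_ge0.
have r0 : 0 <= (`|x| / N) `^ p by exact: powR_ge0.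
have r1 : (`|x| / N) `^ p <= 1.
  apply: powR_le1; last exact: ltW.
  by rewrite divr_gt0//= ler_pdivrMr// mul1r.
move: (_ * N `^ _) (_ `^ p) w0 r0 r1 => w u w0 u0 u1.
have : 0 <= w * u <= w by rewrite mulr_ge0//= ler_piMr.
rewrite ler_norml; nra.
Qed.

Lemma lp_norm_ge0 d p (z : d.-tuple R) : 0 <= lp_norm p z.
Proof. exact: powR_ge0. Qed.

Lemma lp_norm_ge d p (z : d.-tuple R) i : 0 < p -> `|tnth z i| <= lp_norm p z.
Proof.
move=> p0; rewrite /lp_norm.
rewrite -[leLHS](powRr1 (normr_ge0 _)) -(divff (negbT (gt_eqF p0))) powRrM.
have s0 : 0 <= \sum_(j < d) `|tnth z j| `^ p by apply: sumr_ge0 => j _; exact: powR_ge0.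
apply: le_powR; rewrite ?invr_ge0 ?(ltW p0) ?powR_ge0//.
by rewrite (bigD1 i)//= lerDl sumr_ge0// => j _; exact: powR_ge0.
Qed.

Lemma lp_normX d p (z : d.-tuple R) : 0 < p -> lp_norm p z `^ p = \sum_(i < d) `|tnth z i| `^ p.
Proof.
move=> p0; rewrite /lp_norm -powRrM mulVf ?gt_eqF// powRr1//.
by apply: sumr_ge0 => i _; exact: powR_ge0.
Qed.

(** With r_i = |z_i| / N, all in ]0, 1] and with r_i^p adding up to 1, put
    A = sum r_i^(-alpha) and Q = sum r_i^(2-alpha). As r_i^(-alpha) is sorted
    opposite to r_i^p and to r_i^(2-alpha), Chebyshev's sum inequality gives
    d sum r_i^(p-alpha) <= A and d sum r_i^(2-2alpha) <= A Q. So, up to the factor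
    N^(-2), d times the right-hand side is at least
    2 ((1-alpha) d - (2-alpha)) A = 2 (d-2-alpha(d-1)) A, and d times the left-hand
    side is at most y A Q; the bound on y and the bound on Q conclude. *)
Lemma shrink_divergence_bound d p alpha (z : d.-tuple R) y :
  (3 <= d)%N -> 0 < p -> 0 <= alpha -> alpha < (d%:R - 2) / (d%:R - 1) ->
  (forall i, tnth z i != 0) -> 0 <= y <= 2 * (d%:R - 2) * gamma_bound d p alpha ->
  y * (\sum_(i < d) shrink alpha (lp_norm p z) (tnth z i) ^+ 2) <=
  2 * \sum_(i < d) dshrink p alpha (lp_norm p z) (tnth z i).
Proof.
move=> d3 p0 a0 a1 z0 /andP[y0 yb].
have D3 : 3 <= d%:R :> R by rewrite (ler_nat R 3).
have ad : alpha * (d%:R - 1) < d%:R - 2 by rewrite -ltr_pdivlMr//; lra.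
have al1 : alpha < 1 by nra.
pose i0 : 'I_d := Ordinal (leq_trans (isT : (0 < 3)%N) d3).
set N := lp_norm p z.
have t0 i : 0 < `|tnth z i| by rewrite normr_gt0.
have N0 : 0 < N by apply: lt_le_trans (t0 i0) _; exact: lp_norm_ge.
pose r i := `|tnth z i| / N.
have r0 i : 0 < r i by rewrite divr_gt0.
have r1 i : r i <= 1 by rewrite ler_pdivrMr// mul1r; exact: lp_norm_ge.
have rE i : `|tnth z i| = r i * N by rewrite divfK// gt_eqF.
have rp : \sum_i r i `^ p = 1.
  under eq_bigr do rewrite /r powRM ?invr_ge0 ?(ltW N0) ?normr_ge0//.
  rewrite -mulr_suml -lp_normX// -/N -powRM ?invr_ge0 ?(ltW N0)// divff ?gt_eqF//.
  by rewrite powR1.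
under eq_bigr do rewrite (shrink_normalized alpha (r0 _) N0 (rE _)).
under [in leRHS]eq_bigr do rewrite (dshrink_normalized p alpha (r0 _) N0 (rE _)).
rewrite -!mulr_sumr mulrCA [leRHS]mulrCA ler_wpM2l ?powR_ge0//.
rewrite sumrB -!mulr_sumr.
have anti (q : R) : 0 <= q -> forall i j, (r i `^ (- alpha) - r j `^ (- alpha)) * (r i `^ q - r j `^ q) <= 0.
  move=> q0 i j; have [rij|rji] := leP (r i) (r j).
    rewrite mulr_ge0_le0// ?subr_ge0 ?subr_le0.
      by apply: powR_anti_mono => //; lra.
    by apply: le_powR => //; rewrite ltW.
  rewrite mulr_le0_ge0// ?subr_ge0 ?subr_le0.
    by apply: powR_anti_mono => //; [exact/ltW|lra].
  by apply: le_powR => //; rewrite ltW.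
have C1 := chebyshev_sum_le (anti p (ltW p0)).
have q0 : 0 < 2 - alpha by lra.
have C2 := chebyshev_sum_le (anti (2 - alpha) (ltW q0)).
have r01 i : 0 < r i <= 1 by rewrite r0 r1.
have LB := lp_unit_sphere_bound p0 q0 r01 rp.
rewrite rp mulr1 in C1.
rewrite -(ler_pM2l (lt_le_trans (ltr0n R 3) D3)).
have cE : (d%:R - 2) * (1 - alpha * ((d%:R - 1) / (d%:R - 2))) = d%:R - 2 - alpha * (d%:R - 1).
  by field; lra.
move: yb; rewrite /gamma_bound (_ : 2 - p - alpha = 2 - alpha - p); last by ring.
rewrite [X in y <= X](_ : _ = Num.min 1 (d%:R `^ ((2 - alpha - p) / p)) *
  (2 * ((d%:R - 2) * (1 - alpha * ((d%:R - 1) / (d%:R - 2)))))); last by ring.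
rewrite cE => yb.
have m0 : 0 <= Num.min 1 (d%:R `^ ((2 - alpha - p) / p)) by rewrite le_min ler01 powR_ge0.
have A0 : 0 <= \sum_i r i `^ (- alpha) by apply: sumr_ge0 => i _; exact: powR_ge0.
have Q0 : 0 <= \sum_i r i `^ (2 - alpha) by apply: sumr_ge0 => i _; exact: powR_ge0.
move: LB C1 C2 m0 A0 Q0 yb.
move: (Num.min _ _) (\sum_i r i `^ (- alpha)) (\sum_i r i `^ (2 - alpha)) => m A Q.
move: (\sum_i _) (\sum_i _) => S2 S1 mQ h1 h2 m0 A0 Q0 yb.
set K := d%:R - 2 - alpha * (d%:R - 1) in yb.
have K0 : 0 <= K by rewrite /K; lra.
have l1 : d%:R * (y * S2) <= y * (A * Q) by rewrite mulrCA ler_wpM2l.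
have l2 : y * (A * Q) <= m * (2 * K) * (A * Q) by rewrite ler_wpM2r// mulr_ge0.
have l3 : m * (2 * K) * (A * Q) <= 2 * K * A.
  have -> : m * (2 * K) * (A * Q) = 2 * K * A * (m * Q) by ring.
  by rewrite ler_piMr// !mulr_ge0.
have l4 : (2 - alpha) * (d%:R * S1) <= (2 - alpha) * A by rewrite ler_wpM2l// ltW.
have -> : d%:R * (2 * ((1 - alpha) * A - (2 - alpha) * S1)) =
   2 * ((1 - alpha) * d%:R * A - (2 - alpha) * (d%:R * S1)) by ring.
have KE : 2 * K * A = 2 * ((1 - alpha) * d%:R * A - (2 - alpha) * A) by rewrite /K; ring.
rewrite KE in l3; lra.
Qed.

End shrinkage_factor.

Section slice_calculus.
Context {R : realType}.
Variables (p alpha c : R).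
Hypotheses (p0 : 0 < p) (alpha0 : 0 <= alpha) (alpha1 : alpha < 1) (c0 : 0 < c).

Let alphaB2 : alpha - 2 <= 0.
Proof. by rewrite subr_le0 (le_trans (ltW alpha1))// ler1n. Qed.

(* The l^p norm of a vector and the shrinkage direction along the i-th axis, as
   functions of the i-th coordinate x > 0; [c] is the sum of the p-th powers of
   the other coordinates. *)
Let N (x : R) := (c + `|x| `^ p) `^ p^-1.
Let a (x : R) := x `^ (1 - alpha) * (c + x `^ p) `^ ((alpha - 2) / p).
Let a' (x : R) := (1 - alpha) * (x `^ (- alpha) * (c + x `^ p) `^ ((alpha - 2) / p)) -
  (2 - alpha) * (x `^ (p - alpha) * (c + x `^ p) `^ ((alpha - 2 - p) / p)).

Let G0 (x : R) : 0 < c + x `^ p. Proof. by rewrite ltr_pwDl// powR_ge0. Qed.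

Let powR_N (x u : R) : 0 < x -> N x `^ u = (c + x `^ p) `^ (u / p).
Proof. by move=> x0; rewrite /N gtr0_norm// -powRrM mulrC. Qed.

Let N_gt0 x : 0 < N x. Proof. by rewrite powR_gt0// ltr_pwDl// powR_ge0. Qed.

Let norm_le_N x : `|x| <= N x.
Proof.
rewrite /N -[leLHS](powRr1 (normr_ge0 _)) -(divff (negbT (gt_eqF p0))) powRrM.
by apply: le_powR; rewrite ?invr_ge0 ?(ltW p0) ?powR_ge0// lerDr ltW.
Qed.

Let c_le_N x : c `^ p^-1 <= N x.
Proof. by apply: le_powR; rewrite ?invr_ge0 ?(ltW p0) ?(ltW c0)// lerDl powR_ge0. Qed.

Lemma shrink_slice x : 0 < x -> shrink alpha (N x) x = a x.
Proof.
move=> x0; rewrite /shrink /a (gtr0_norm x0) -powR_N// (@pos_powRB R x 1 alpha)// powRr1 ?(ltW x0)//.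
rewrite -[alpha - 2]opprB powRN; have := powR_gt0 (2 - alpha) (N_gt0 x).
have := powR_gt0 alpha x0; move: (_ `^ _) (_ `^ _) => u v u0 v0.
by field; rewrite !gt_eqF.
Qed.

Lemma dshrink_slice x : 0 < x -> dshrink p alpha (N x) x = a' x.
Proof. by move=> x0; rewrite /dshrink /a' (gtr0_norm x0) -!powR_N. Qed.

Lemma shrinkN N' x : shrink alpha N' (- x) = - shrink alpha N' x.
Proof. by rewrite /shrink normrN mulNr. Qed.

Lemma dshrinkN N' x : dshrink p alpha N' (- x) = dshrink p alpha N' x.
Proof. by rewrite /dshrink normrN. Qed.

Lemma is_derive_shrink_slice (x : R) : 0 < x -> is_derive x 1 a (a' x).
Proof.
move=> x0.
have dG : is_derive x 1 (fun y : R => c + y `^ p) (0 + p * x `^ (p - 1)).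
  exact: is_deriveD (is_derive_cst c x 1) (is_derive1_powR p x0).
have dGu := @is_derive1_comp R (@powR R ^~ ((alpha - 2) / p)) (fun y => c + y `^ p) x _ _
  (is_derive1_powR ((alpha - 2) / p) (G0 x)) dG.
have := is_deriveM (is_derive1_powR (1 - alpha) x0) dGu.
move=> /is_derive_eq; apply; rewrite /GRing.scale/= /a' add0r.
have -> : (alpha - 2) / p - 1 = (alpha - 2 - p) / p by field; rewrite gt_eqF.
have -> : 1 - alpha - 1 = - alpha by ring.
have -> : x `^ (p - alpha) = x `^ (1 - alpha) * x `^ (p - 1).
  by rewrite -pos_powRD//; congr (_ `^ _); ring.
move: (_ `^ _) (_ `^ _) (_ `^ _) (_ `^ _) (_ `^ _) => u v w t z.
by field; rewrite gt_eqF.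
Qed.

Lemma continuous_dshrink_slice (x : R) : 0 < x -> {for x, continuous a'}.
Proof.
move=> x0.
have cp (u y : R) : 0 < y -> {for y, continuous (fun z : R => z `^ u)}.
  move=> y0; apply/differentiable_continuous/derivable1_diffP.
  by have [] := is_derive1_powR u y0.
have cG u : {for x, continuous (fun z : R => (c + z `^ p) `^ u)}.
  apply: (@continuous_comp _ _ _ (fun z => c + z `^ p) (fun z => z `^ u)); last exact: cp.
  by apply: cvgD; [exact: cvg_cst|exact: cp].
have cterm k u v : {for x, continuous (fun z : R => k * (z `^ u * (c + z `^ p) `^ v))}.
  by apply: cvgM; [exact: cvg_cst|apply: cvgM; [exact: cp|exact: cG]].
apply: cvgB; exact: cterm.
Qed.

Let C := c `^ p^-1 `^ (- 1) + 3 * c `^ p^-1 `^ (alpha - 2).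

Lemma shrink_slice_bounded x : 0 < x -> 0 <= a x <= C.
Proof.
move=> x0; have ax0 : 0 <= a x by rewrite mulr_ge0 ?powR_ge0.
rewrite ax0/= /a -powR_N//.
have cp : 0 < c `^ p^-1 by exact: powR_gt0.
apply: (@le_trans _ _ (c `^ p^-1 `^ (- 1))); last by rewrite lerDl mulr_ge0 ?powR_ge0.
apply: (@le_trans _ _ (N x `^ (1 - alpha) * N x `^ (alpha - 2))).
  rewrite ler_wpM2r ?powR_ge0//; apply: le_powR; [by rewrite subr_ge0 ltW|exact: ltW|].
  by have := norm_le_N x; rewrite {1}(gtr0_norm x0).
rewrite -(pos_powRD _ _ (N_gt0 x)).
have -> : 1 - alpha + (alpha - 2) = - 1 by ring.
exact: (powR_anti_mono cp (c_le_N x) (lerN10 R)).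
Qed.

Lemma dshrink_slice_bounded x : 0 < x -> `|a' x| <= C * x `^ (- alpha).
Proof.
move=> x0; rewrite -dshrink_slice//.
apply: le_trans (dshrink_le p0 alpha0 alpha1 _) _; first by rewrite normr_gt0 gt_eqF//= norm_le_N.
rewrite (gtr0_norm x0) [x `^ _ * _]mulrC mulrA ler_wpM2r ?powR_ge0//.
apply: (@le_trans _ _ (3 * c `^ p^-1 `^ (alpha - 2))); last by rewrite lerDr powR_ge0.
have cp : 0 < c `^ p^-1 by exact: powR_gt0.
apply: ler_wpM2l; [exact: ler0n|exact: (powR_anti_mono cp (c_le_N x) alphaB2)].
Qed.

Lemma slice_norm_mono x y : 0 < x -> x <= y -> N x <= N y.
Proof.
move=> x0 xy; apply: le_powR; rewrite ?invr_ge0 ?(ltW p0) ?addr_ge0 ?(ltW c0) ?powR_ge0//.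
by rewrite lerD2l !ger0_norm ?(ltW x0) ?(le_trans (ltW x0) xy)//; apply: le_powR => //; exact: ltW.
Qed.

(** Since the other coordinates are not all zero, [c] is positive: the norm stays
    away from 0 and the component is bounded near 0, although its derivative blows
    up like |x|^(-alpha) there. *)
Lemma stein_inequality_slice (s m B : R) (b H : R -> R) : s != 0 ->
  measurable_fun [set: R] b ->
  (forall x y : R, 0 < x -> x <= y -> b x <= b y) -> (forall x, b (- x) = b x) ->
  (forall x : R, 0 < x -> 0 <= b x <= B) ->
  measurable_fun [set: R] H ->
  (forall x, x != 0 -> H x = b x * ((x - m) * shrink alpha (N x) x -
                              s ^+ 2 * dshrink p alpha (N x) x)) ->
  (\int[normal_law m s]_x (EFin \o H)^\- x <= \int[normal_law m s]_x (EFin \o H)^\+ x)%E.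
Proof.
move=> s0 mb b_mono bN bB mH HE.
have NN x : N (- x) = N x by rewrite /N normrN.
apply: (@stein_inequality R s alpha C B a a' b) => //.
- exact: is_derive_shrink_slice.
- exact: continuous_dshrink_slice.
- exact: shrink_slice_bounded.
- exact: dshrink_slice_bounded.
- by move=> x x0; rewrite HE ?gt_eqF// shrink_slice// dshrink_slice.
- move=> x x0; rewrite HE ?oppr_eq0 ?gt_eqF// NN bN shrinkN dshrinkN shrink_slice// dshrink_slice//.
  by congr (_ * (_ - _)); ring.
Qed.

End slice_calculus.

(** * The risk of the shrinkage estimator *)

Section product_probability.
Context d1 d2 (T1 : measurableType d1) (T2 : measurableType d2) (R : realType).
Variables (P1 : probability T1 R) (P2 : probability T2 R).

Lemma ge0_integral_prod_fst (f : T1 -> \bar R) :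
  measurable_fun [set: T1] f -> (forall x, 0 <= f x)%E ->
  (\int[P1 \x P2]_x f x.1 = \int[P1]_x f x)%E.
Proof.
move=> mf f0; rewrite (fubini_tonelli1 (fun x => f x.1))//; last first.
  by apply: (measurableT_comp mf); exact: measurable_fst.
apply: eq_integral => x _; rewrite /fubini_F/=.
rewrite (_ : (fun y => f x) = cst (f x))//.
by rewrite integral_cst//= probability_setT mule1.
Qed.

Lemma ge0_integral_prod_snd (f : T2 -> \bar R) :
  measurable_fun [set: T2] f -> (forall x, 0 <= f x)%E ->
  (\int[P1 \x P2]_x f x.2 = \int[P2]_x f x)%E.
Proof.
move=> mf f0; rewrite (fubini_tonelli2 (fun x => f x.2))//; last first.
  by apply: (measurableT_comp mf); exact: measurable_snd.
apply: eq_integral => x _; rewrite /fubini_G/=.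
rewrite (_ : (fun y => f x) = cst (f x))//.
by rewrite integral_cst//= probability_setT mule1.
Qed.

Lemma integrable_prod_mul (f : T1 -> R) (g : T2 -> R) :
  P1.-integrable [set: T1] (EFin \o f) -> P2.-integrable [set: T2] (EFin \o g) ->
  (P1 \x P2)%E.-integrable [set: T1 * T2] (fun x => (f x.1 * g x.2)%:E).
Proof.
move=> /integrableP[/measurable_EFinP mf fi] /integrableP[/measurable_EFinP mg gi].
have mfg : measurable_fun [set: T1 * T2] (fun x => (f x.1 * g x.2)%:E).
  apply/measurable_EFinP; apply: measurable_funM.
    by apply: (measurableT_comp mf); exact: measurable_fst.
  by apply: (measurableT_comp mg); exact: measurable_snd.
apply/(integrable12ltyP _ _ mfg).
have mEg : measurable_fun [set: T2] (fun y => `|(g y)%:E|)%E.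
  by apply: measurableT_comp => //; exact/measurable_EFinP.
have mEf : measurable_fun [set: T1] (fun y => `|(f y)%:E|)%E.
  by apply: measurableT_comp => //; exact/measurable_EFinP.
have -> : (\int[P1]_x \int[P2]_y `|(f (x, y).1 * g (x, y).2)%:E| =
    \int[P1]_x `|(f x)%:E| * \int[P2]_y `|(g y)%:E|)%E.
  rewrite -ge0_integralZr//; last exact: integral_ge0.
  apply: eq_integral => x _; rewrite -ge0_integralZl//.
  by apply: eq_integral => y _; rewrite EFinM abseM.
apply: lte_mul_pinfty => //; first exact: integral_ge0.
by rewrite ge0_fin_numE//; exact: integral_ge0.
Qed.

End product_probability.

Section normal_vec_facts.
Context {R : realType}.

Lemma measurable_eq0 : measurable_fun [set: R] (fun x : R => (x == 0)%:R : R).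
Proof.
have -> : (fun x : R => (x == 0)%:R : R) = \1_[set 0].
  apply/funext => x; rewrite indicE; congr (nat_of_bool _)%:R.
  by apply/eqP/idP => [->|/set_mem//]; exact/mem_set.
exact: measurable_indic.
Qed.

Lemma measurable_nneg : measurable_fun [set: R] (fun x : R => (0 <= x)%R%:R : R).
Proof.
have -> : (fun x : R => (0 <= x)%R%:R : R) = \1_`[0, +oo[.
  apply/funext => x; rewrite indicE; congr (nat_of_bool _)%:R.
  apply/idP/idP => [x0|/set_mem/=]; last by rewrite in_itv/= andbT.
  by apply/mem_set; rewrite /= in_itv/= x0.
exact: measurable_indic.
Qed.

Lemma normal_law_null (m s : R) : s != 0 ->
  (\int[normal_law m s]_x (x == 0)%R%:R%:E = 0 :> \bar R)%E.
Proof.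
move=> s0; have m0 := measurable_eq0.
rewrite integral_normal_law//.
transitivity (\int[lebesgue_measure]_(x in [set 0%R]) (normal_pdf m s x)%:E)%E.
  rewrite [RHS]integral_mkcond; apply: eq_integral => x _; rewrite patchE.
  have [->|x0] := eqVneq x 0; first by rewrite mem_set// mul1r.
  by rewrite memNset ?mul0r//= => /eqP; rewrite (negbTE x0).
exact: integral_set1.
Qed.

Lemma ge0_integral_normal_vec_coord d (s : R) (theta : d.-tuple R) (i : 'I_d) (f : R -> R) (c : R) :
  measurable_fun [set: R] f -> (forall x, 0 <= f x) ->
  (\int[normal_law (tnth theta i) s]_x (f x)%:E = c%:E)%E ->
  (\int[normal_vec s theta]_z (f (tnth z i))%:E = c%:E)%E.
Proof.
move=> mf f0 fc.
pose g (j : 'I_d) x := if j == i then f x else 1.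
pose k (j : 'I_d) := if j == i then c else 1.
have := @integral_normal_vec_prod R s d theta g k.
have -> : \prod_(j < d) k j = c by rewrite /k -big_mkcond/= big_pred1_eq.
under eq_integral do rewrite /g -big_mkcond/= big_pred1_eq.
apply.
- by move=> j; rewrite /g; case: (j == i).
- by move=> j x; rewrite /g; case: (j == i).
- move=> j; rewrite /g /k; case: eqP => [->//|_].
  by rewrite integral_cst//= mul1e probability_setT.
Qed.

(** The left-hand side dominates, up to a constant, both the square and the
    derivative of the shrinkage direction. It is homogeneous of degree -2, and so is the right-hand
    side: the factor N^(alpha-2) is shared among the coordinates, all at most N, so
    that each exponent stays above -1 and the product is integrable. With two
    coordinates this would be impossible. *)
Lemma shrink_weight_le d p alpha (z : d.-tuple R) i :
  (3 <= d)%N -> 0 < p -> alpha < 1 -> (forall j, tnth z j != 0) ->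
  `|tnth z i| `^ (- alpha) * lp_norm p z `^ (alpha - 2) <=
  \prod_(j < d) `|tnth z j| `^ (- (if j == i then (1 + alpha) / 2 else (3 - alpha) / (2 * (d%:R - 1)))).
Proof.
move=> d3 p0 a1 z0; set e := (3 - alpha) / _; set N := lp_norm p z.
have t0 j : 0 < `|tnth z j| by rewrite normr_gt0.
have tN j : `|tnth z j| <= N by exact: lp_norm_ge.
have N0 : 0 < N by exact: lt_le_trans (t0 i) (tN i).
have D3 : 3 <= d%:R :> R by rewrite (ler_nat R 3).
have e0 : 0 <= e by rewrite divr_ge0//; lra.
rewrite (bigD1 i)//= eqxx.
have -> : alpha - 2 = - ((1 - alpha) / 2) + (- e * (d.-1)%:R).
  have -> : (d.-1)%:R = d%:R - 1 :> R by rewrite -subn1 natrB// (leq_trans _ d3).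
  by rewrite /e; field; lra.
have -> : - ((1 + alpha) / 2) = - alpha + (- ((1 - alpha) / 2)) by field.
rewrite !pos_powRD// mulrA; apply: ler_pM.
- by rewrite mulr_ge0 ?powR_ge0.
- exact: powR_ge0.
- by rewrite ler_wpM2l ?powR_ge0//; apply: powR_anti_mono => //; lra.
rewrite powRrM powR_mulrn ?powR_ge0//.
have -> : N `^ (- e) ^+ d.-1 = \prod_(j < d | j != i) N `^ (- e).
  by rewrite prodr_const cardC1 card_ord.
apply: ler_prod => j ji; rewrite (negbTE ji) powR_ge0/=.
by apply: powR_anti_mono => //; lra.
Qed.

Lemma integral_powRN_prod_lty d (s alpha : R) (theta : d.-tuple R) i :
  s != 0 -> (3 <= d)%N -> 0 <= alpha -> alpha < 1 ->
  (\int[normal_vec s theta]_z (\prod_(j < d) `|tnth z j| `^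
     (- (if j == i then (1 + alpha) / 2 else (3 - alpha) / (2 * (d%:R - 1)))))%:E < +oo)%E.
Proof.
move=> s0 d3 a0 a1.
have D3 : 3 <= d%:R :> R by rewrite (ler_nat R 3).
pose e (j : 'I_d) := if j == i then (1 + alpha) / 2 else (3 - alpha) / (2 * (d%:R - 1)).
have e01 j : 0 <= e j < 1.
  rewrite /e; case: ifP => _; first by lra.
  by rewrite divr_ge0 ?ltr_pdivrMr//; lra.
pose c j := fine (\int[normal_law (tnth theta j) s]_x (`|x| `^ (- e j))%:E)%E.
rewrite (@integral_normal_vec_prod R s d theta (fun j x => `|x| `^ (- e j)) c) ?ltry//.
- by move=> j; apply: (measurableT_comp (measurable_powR _)); exact: normr_measurable.
- move=> j; have /andP[ej0 ej1] := e01 j; rewrite /c fineK// ge0_fin_numE.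
    exact: normal_powRN_lty.
  by apply: integral_ge0 => x _; rewrite lee_fin powR_ge0.
Qed.

End normal_vec_facts.

(** A function that is at most a sum of terms q_i + (A_i - 2 B_i) has its mean
    bounded through the signs of the means of A_i and B_i, which need to be known
    only as comparisons of positive and negative parts. *)
Lemma integral_le_card d0 (T : measurableType d0) (R : realType) (P : probability T R)
    d (L : T -> R) (q A B : 'I_d -> T -> R) :
  measurable_fun [set: T] L -> (forall x, 0 <= L x) ->
  (forall i, measurable_fun [set: T] (q i)) -> (forall i x, 0 <= q i x) ->
  (forall i, \int[P]_x (q i x)%:E = 1)%E ->
  (forall i, P.-integrable [set: T] (EFin \o A i)) ->
  (forall i, P.-integrable [set: T] (EFin \o B i)) ->
  (forall i, \int[P]_x (EFin \o A i)^\+ x <= \int[P]_x (EFin \o A i)^\- x)%E ->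
  (forall i, \int[P]_x (EFin \o B i)^\- x <= \int[P]_x (EFin \o B i)^\+ x)%E ->
  (forall x, 0 <= \sum_(i < d) (q i x + (A i x - 2 * B i x))) ->
  {ae P, forall x, L x <= \sum_(i < d) (q i x + (A i x - 2 * B i x))} ->
  (\int[P]_x (L x)%:E <= d%:R%:E)%E.
Proof.
move=> mL L0 mq q0 q1 iA iB A0 B0 Y0 LY.
have iq i : P.-integrable [set: T] (EFin \o q i).
  apply/integrableP; split; first exact/measurable_EFinP.
  by under eq_integral do rewrite /= ger0_norm//; rewrite q1 ltry.
have i2B i : P.-integrable [set: T] (fun x => 2%:E * (EFin \o B i) x)%E.
  exact: integrableZl.
have iAB i : P.-integrable [set: T] ((EFin \o A i) \- (fun x => 2%:E * (EFin \o B i) x))%E.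
  exact: integrableB.
have it i : P.-integrable [set: T] (fun x => (q i x + (A i x - 2 * B i x))%:E).
  by apply: eq_integrable (integrableD measurableT (iq i) (iAB i)).
have mt i : measurable_fun [set: T] (fun x => q i x + (A i x - 2 * B i x)).
  by have /integrableP[/measurable_EFinP] := it i.
apply: (@le_trans _ _ (\int[P]_x (\sum_(i < d) (q i x + (A i x - 2 * B i x)))%:E)%E).
  apply: ae_ge0_le_integral => //.
  - by move=> x _; rewrite lee_fin.
  - exact/measurable_EFinP.
  - by move=> x _; rewrite lee_fin.
  - by apply/measurable_EFinP; exact: measurable_sum.
  - by apply: filterS LY => x Lx _; rewrite lee_fin.
under eq_integral do rewrite -sumEFin.
rewrite integral_sum//.
have -> : d%:R%:E = (\sum_(i < d) 1 : \bar R)%E.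
  by rewrite sumEFin sumr_const card_ord.
apply: lee_sum => i _.
have -> : (\int[P]_x (q i x + (A i x - 2 * B i x))%:E =
    \int[P]_x (((EFin \o q i) \+ ((EFin \o A i) \- (fun x => 2%:E * (EFin \o B i) x))) x))%E by [].
rewrite integralD// [X in (X + _)%E](q1 i) integralB// integralZl// geeDl//.
have B1 : (0 <= \int[P]_x (EFin \o B i) x)%E by apply/(funeneg_le_funeposP measurableT (iB i)).
have A1 : (\int[P]_x (EFin \o A i) x <= 0)%E.
  by rewrite integralE sube_le0.
rewrite sube_le0; apply: le_trans A1 _; exact: mule_ge0.
Qed.

Lemma ae_of_integral0 d0 (T : measurableType d0) (R : realType) (P : probability T R)
    (good : T -> bool) :
  measurable_fun [set: T] (fun x => (good x)%:R : R) ->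
  (\int[P]_x (~~ good x)%:R%:E = 0 :> \bar R)%E -> {ae P, forall x, good x}.
Proof.
move=> mg; have mb : measurable [set x | ~~ good x].
  have -> : [set x | ~~ good x] = (fun x => (good x)%:R : R) @^-1` [set 0].
    apply/seteqP; split => x /=; first by move=> /negbTE ->.
    by case: (good x) => //= /eqP; rewrite oner_eq0.
  by rewrite -[X in measurable X]setTI; apply: mg.
move=> P0; exists [set x | ~~ good x]; split => //; last by move=> x /= /negP.
rewrite -P0 -[X in P X]setIT -(integral_indic P measurableT mb).
apply: eq_integral => x _; rewrite indicE; congr (nat_of_bool _)%:R%:E.
by apply/idP/idP => [/set_mem|/mem_set].
Qed.

Section shrinkage_risk.
Context {R : realType}.
Variables (d n : nat) (p alpha K : R) (phi : R -> R).
Hypotheses (d3 : (3 <= d)%N) (p0 : 0 < p) (alpha0 : 0 <= alpha).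
Hypothesis alpha_lt : alpha < (d%:R - 2) / (d%:R - 1).
Hypothesis phi_mono : forall u v : R, u <= v -> phi u <= phi v.
Hypothesis phi_bd : forall u : R, 0 <= phi u <= K.
Hypothesis K_bd : K <= 2 * (d%:R - 2) * gamma_bound d p alpha.

Let alpha1 : alpha < 1.
Proof.
apply: lt_le_trans alpha_lt _; have D3 : 3 <= d%:R :> R by rewrite (ler_nat R 3).
by rewrite ler_pdivrMr; lra.
Qed.

Let K0 : 0 <= K. Proof. by have /andP[] := phi_bd 0; exact: le_trans. Qed.

Let mphi : measurable_fun [set: R] phi.
Proof. exact: nondecreasing_measurable. Qed.

Let n2_gt0 : 0 < n%:R + 2 :> R. Proof. by rewrite ltr_wpDl. Qed.

Let vhat (s : R) := s / (n%:R + 2).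
Let arg (zs : d.-tuple R * R) := lp_norm p zs.1 / Num.sqrt (vhat zs.2).
Let h i (z : d.-tuple R) := shrink alpha (lp_norm p z) (tnth z i).
Let D i (z : d.-tuple R) := dshrink p alpha (lp_norm p z) (tnth z i).
(* Almost surely true, and all that the pointwise bounds rely on. *)
Let good (zs : d.-tuple R * R) := [forall i, tnth zs.1 i != 0] && (0 <= zs.2).

Let vhat_ge0 s : (0 <= vhat s) = (0 <= s).
Proof. by rewrite /vhat pmulr_lge0// invr_gt0. Qed.

Lemma tnth_theta_hat zs i :
  tnth (theta_hat n p alpha phi zs) i = tnth zs.1 i - vhat zs.2 * phi (arg zs) * h i zs.1.
Proof.
case: zs => z s; rewrite tnth_mktuple mulrBl mul1r/=; congr (_ - _).
by rewrite mulrAC [RHS]mulrA.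
Qed.

Lemma measurable_lp_norm : measurable_fun [set: d.-tuple R] (lp_norm p).
Proof.
apply: (measurableT_comp (measurable_powR _)); apply: measurable_sum => i.
apply: (measurableT_comp (measurable_powR _)).
by apply: (measurableT_comp (@normr_measurable R setT)); exact: measurable_tnth.
Qed.

Let mcoord i : measurable_fun [set: d.-tuple R] (fun z => `|tnth z i|).
Proof. by apply: (measurableT_comp (@normr_measurable R setT)); exact: measurable_tnth. Qed.

Let mh i : measurable_fun [set: d.-tuple R] (h i).
Proof.
apply: measurable_funM; first exact: measurable_tnth.
have -> : (fun z : d.-tuple R => (lp_norm p z `^ (2 - alpha) * `|tnth z i| `^ alpha)^-1) =
  (fun z => lp_norm p z `^ (- (2 - alpha)) * `|tnth z i| `^ (- alpha)).
  by apply/funext => z; rewrite invfM -!powRN.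
apply: measurable_funM; apply: (measurableT_comp (measurable_powR _)) => //.
exact: measurable_lp_norm.
Qed.

Let mD i : measurable_fun [set: d.-tuple R] (D i).
Proof.
have mN := measurable_lp_norm.
by apply: measurable_funB; apply: measurable_funM => //; apply: measurable_funM;
  apply: (measurableT_comp (measurable_powR _)).
Qed.

Let mvhat : measurable_fun [set: R] vhat.
Proof. exact: measurable_funM. Qed.

Let mphi_arg : measurable_fun [set: d.-tuple R * R] (fun zs => phi (arg zs)).
Proof.
apply: (measurableT_comp mphi); apply: measurable_funM.
  by apply: (measurableT_comp measurable_lp_norm); exact: measurable_fst.
have -> : (fun zs : d.-tuple R * R => (Num.sqrt (vhat zs.2))^-1) =
    (fun zs => (Num.sqrt (vhat zs.2)) `^ (- 1)).
  by apply/funext => zs; rewrite powR_inv1 ?sqrtr_ge0.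
apply: (measurableT_comp (measurable_powR _)).
have ms : measurable_fun [set: R] (@Num.sqrt R).
  by apply: continuous_measurable_fun; exact: sqrt_continuous.
apply: (measurableT_comp ms).
by apply: (measurableT_comp mvhat); exact: measurable_snd.
Qed.

Lemma theta_hat_estimator : estimator (theta_hat n p alpha phi : d.-tuple R * R -> d.-tuple R).
Proof.
apply/measurable_fun_tnthP => i.
rewrite (_ : _ \o _ = fun zs => tnth zs.1 i - vhat zs.2 * phi (arg zs) * h i zs.1); last first.
  by apply/funext => zs /=; rewrite tnth_theta_hat.
apply: measurable_funB.
  by apply: (measurableT_comp (measurable_tnth i)); exact: measurable_fst.
apply: measurable_funM; last by apply: (measurableT_comp (mh i)); exact: measurable_fst.
by apply: measurable_funM => //; apply: (measurableT_comp mvhat); exact: measurable_snd.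
Qed.

Let mgood : measurable_fun [set: d.-tuple R * R] (fun zs => (good zs)%:R : R).
Proof.
have -> : (fun zs => (good zs)%:R : R) =
    fun zs => (\prod_i (1 - (tnth zs.1 i == 0)%:R)) * (0 <= zs.2)%R%:R.
  apply/funext => -[z s]; rewrite /good/= -mulnb natrM; congr (_ * _).
  have [/forallP z0|] := boolP [forall i, tnth z i != 0].
    by rewrite big1// => i _; rewrite (negbTE (z0 i)) subr0.
  by move=> /forallPn[i]; rewrite negbK => zi; rewrite (bigD1 i)//= zi subrr mul0r.
apply: measurable_funM; last exact: (measurableT_comp measurable_nneg measurable_snd).
apply: measurable_prod => i _; apply: measurable_funB => //.
exact: (measurableT_comp measurable_eq0 (measurableT_comp (measurable_tnth i) measurable_fst)).
Qed.

Section fixed_parameter.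
Variables (theta : d.-tuple R) (sigma2 : R).
Hypothesis sigma2_gt0 : 0 < sigma2.

Let sig := Num.sqrt sigma2.
Let sig0 : sig != 0. Proof. by rewrite gt_eqF// sqrtr_gt0. Qed.
Let sig2E : sig ^+ 2 = sigma2. Proof. by rewrite sqr_sqrtr// ltW. Qed.

(* The cross and square terms of the loss, to which the divergence term
   v phi (phi h^2 - 2 D) has been added and subtracted: what is left in [A] has a
   sign once averaged over s, what is left in [B] once averaged over z_i. Both are
   cut off outside the almost sure event [good]. *)
Let A i zs := (good zs)%:R *
  (h i zs.1 ^+ 2 * phi (arg zs) ^+ 2 * (vhat zs.2 ^+ 2 / sigma2 - vhat zs.2)).
Let B i zs := (good zs)%:R *
  (vhat zs.2 * phi (arg zs) / sigma2 *
   ((tnth zs.1 i - tnth theta i) * h i zs.1 - sigma2 * D i zs.1)).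
Let Y zs := \sum_(i < d) ((tnth zs.1 i - tnth theta i) ^+ 2 / sigma2 + (A i zs - 2 * B i zs)).

Let mA i : measurable_fun [set: d.-tuple R * R] (A i).
Proof.
apply: measurable_funM => //; apply: measurable_funM.
  apply: measurable_funM; apply: measurable_funX => //.
  by apply: (measurableT_comp (mh i)); exact: measurable_fst.
have mv : measurable_fun [set: d.-tuple R * R] (fun zs => vhat zs.2).
  by apply: (measurableT_comp mvhat); exact: measurable_snd.
by apply: measurable_funB => //; apply: measurable_funM => //; exact: measurable_funX.
Qed.

Let mB i : measurable_fun [set: d.-tuple R * R] (B i).
Proof.
have mv : measurable_fun [set: d.-tuple R * R] (fun zs => vhat zs.2).
  by apply: (measurableT_comp mvhat); exact: measurable_snd.
apply: measurable_funM => //; apply: measurable_funM.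
  by apply: measurable_funM => //; exact: measurable_funM.
apply: measurable_funB; apply: measurable_funM => //.
- apply: measurable_funB => //.
  by apply: (measurableT_comp (measurable_tnth i)); exact: measurable_fst.
- by apply: (measurableT_comp (mh i)); exact: measurable_fst.
- by apply: (measurableT_comp (mD i)); exact: measurable_fst.
Qed.

(* The difference of the two sides is v phi (2 sum D - phi sum h^2). *)
Let loss_le_Y zs : good zs -> loss (theta_hat n p alpha phi zs) theta sigma2 <= Y zs.
Proof.
move=> gz; have /andP[/forallP z0 s0] := gz.
have v0 : 0 <= vhat zs.2 by rewrite vhat_ge0.
have /andP[f0 fK] := phi_bd (arg zs).
have fb : 0 <= phi (arg zs) <= 2 * (d%:R - 2) * gamma_bound d p alpha.
  by rewrite f0/= (le_trans fK).
have := shrink_divergence_bound d3 p0 alpha0 alpha_lt z0 fb.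
rewrite -subr_ge0 => /(mulr_ge0 (mulr_ge0 v0 f0)) le0.
rewrite -subr_ge0; apply: le_trans le0 _; rewrite le_eqVlt; apply/orP; left; apply/eqP.
rewrite mulrBr !mulr_sumr -sumrB [in RHS]/loss -sumrB; apply: eq_bigr => i _.
rewrite tnth_theta_hat /A /B gz !mul1r -/(h i zs.1) -/(D i zs.1).
by field; rewrite gt_eqF.
Qed.

Let nu := normal_vec sig theta.
Let chi := scaled_chi2 n sigma2.
Let law := sample_law n theta sigma2.

Let lp_norm_replace z i y :
  lp_norm p (replace_tnth z i y) = (\sum_(j < d | j != i) `|tnth z j| `^ p + `|y| `^ p) `^ p^-1.
Proof.
rewrite /lp_norm; congr (_ `^ _); rewrite (bigD1 i)//= tnth_mktuple eqxx addrC; congr (_ + _).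
by apply: eq_bigr => j ji; rewrite tnth_mktuple (negbTE ji).
Qed.

Let measurable_replace (z : d.-tuple R) i : measurable_fun [set: R] (replace_tnth z i).
Proof.
apply/measurable_fun_tnthP => j.
rewrite (_ : _ \o _ = fun y => if j == i then y else tnth z j); last first.
  by apply/funext => y /=; rewrite tnth_mktuple.
by case: (j == i).
Qed.

(* If another coordinate is zero or s is negative, [B] vanishes along the whole
   line; otherwise the weight v phi / sigma^2 increases with |z_i|. *)
Let slice_B s (z : d.-tuple R) i :
  (\int[normal_law (tnth theta i) sig]_y (EFin \o B i)^\- (replace_tnth z i y, s) <=
   \int[normal_law (tnth theta i) sig]_y (EFin \o B i)^\+ (replace_tnth z i y, s))%E.
Proof.
pose H y := B i (replace_tnth z i y, s).
have -> : (\int[normal_law (tnth theta i) sig]_y (EFin \o B i)^\- (replace_tnth z i y, s) =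
    \int[normal_law (tnth theta i) sig]_y (EFin \o H)^\- y)%E.
  by apply: eq_integral => y _; rewrite !funenegE.
have -> : (\int[normal_law (tnth theta i) sig]_y (EFin \o B i)^\+ (replace_tnth z i y, s) =
    \int[normal_law (tnth theta i) sig]_y (EFin \o H)^\+ y)%E.
  by apply: eq_integral => y _; rewrite !funeposE.
have [/andP[s0 /forallP zi]|bad] := boolP ((0 <= s) && [forall j, (j != i) ==> (tnth z j != 0)]);
    last first.
  have H0 y : H y = 0.
    rewrite /H /B /good (_ : _ && _ = false) ?mul0r//; apply: contraNF bad.
    move=> /andP[/forallP zz /= ->]; apply/forallP => j; apply/implyP => ji.
    by have := zz j; rewrite tnth_mktuple (negbTE ji).
  apply: ge0_le_integral => //.
  - apply: measurable_funeneg; apply/measurable_EFinP.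
    by rewrite (_ : H = cst 0)//; exact/funext.
  - apply: measurable_funepos; apply/measurable_EFinP.
    by rewrite (_ : H = cst 0)//; exact/funext.
  - by move=> y _; rewrite funenegE funeposE /= H0 oppr0.
have v0 : 0 <= vhat s by rewrite vhat_ge0.
have sv0 : 0 <= (Num.sqrt (vhat s))^-1 by rewrite invr_ge0 sqrtr_ge0.
pose c := \sum_(j < d | j != i) `|tnth z j| `^ p.
have c0 : 0 < c.
  have [j ji] : exists j : 'I_d, j != i.
    have := cardC1 i; rewrite card_ord => cE.
    have /card_gt0P[j ji] : (0 < #|predC1 i|)%N by rewrite cE -subn1 subn_gt0 (leq_trans _ d3).
    by exists j.
  rewrite /c (bigD1 j)//= ltr_pwDl//; last by apply: sumr_ge0 => k _; exact: powR_ge0.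
  by rewrite powR_gt0// normr_gt0; have := zi j; rewrite ji.
pose N (y : R) := (c + `|y| `^ p) `^ p^-1.
pose b (y : R) := vhat s * phi (N y / Num.sqrt (vhat s)) / sigma2.
have mN : measurable_fun [set: R] N.
  apply: (measurableT_comp (measurable_powR _)); apply: measurable_funD => //.
  by apply: (measurableT_comp (measurable_powR _)); exact: normr_measurable.
have mb : measurable_fun [set: R] b.
  apply: measurable_funM => //; apply: measurable_funM => //.
  by apply: (measurableT_comp mphi); exact: measurable_funM.
apply: (@stein_inequality_slice R p alpha c p0 alpha0 alpha1 c0 sig (tnth theta i)
  (vhat s * K / sigma2) b H sig0 mb).
- move=> x y x0 xy; have xyN : N x <= N y by exact: (slice_norm_mono p0 c0 x0 xy).
  have sg : 0 <= sigma2^-1 by rewrite invr_ge0 ltW.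
  exact: (ler_wpM2r sg (ler_wpM2l v0 (phi_mono (ler_wpM2r sv0 xyN)))).
- by move=> x; rewrite /b /N normrN.
- move=> x x0; have /andP[f0 fK] := phi_bd (N x / Num.sqrt (vhat s)).
  have sg : 0 <= sigma2^-1 by rewrite invr_ge0 ltW.
  apply/andP; split; first exact: (mulr_ge0 (mulr_ge0 v0 f0) sg).
  exact: (ler_wpM2r sg (ler_wpM2l v0 fK)).
- apply: (measurableT_comp (mB i)).
  exact: measurable_fun_pair (measurable_replace z i) (measurable_cst s).
- move=> y y0; rewrite /H /B /good /=.
  have -> : [forall j, tnth (replace_tnth z i y) j != 0].
    apply/forallP => j; rewrite tnth_mktuple; case: (eqVneq j i) => [_|ji]; first exact: y0.
    by have := zi j; rewrite ji.
  by rewrite s0 mul1r /h /D /arg /= lp_norm_replace !tnth_mktuple eqxx sig2E.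
Qed.

Let integral_B_neg_le_pos i :
  (\int[law]_zs (EFin \o B i)^\- zs <= \int[law]_zs (EFin \o B i)^\+ zs)%E.
Proof.
have mEB : measurable_fun [set: d.-tuple R * R] (EFin \o B i) by exact/measurable_EFinP.
have mpos := measurable_funepos mEB; have mneg := measurable_funeneg mEB.
rewrite [leLHS](fubini_tonelli2 _ mneg (funeneg_ge0 _)).
rewrite [leRHS](fubini_tonelli2 _ mpos (funepos_ge0 _)).
apply: ge0_le_integral => //.
- by move=> s _; exact: integral_ge0.
- exact: (measurable_fun_fubini_tonelli_G _ mneg (funeneg_ge0 _)).
- exact: (measurable_fun_fubini_tonelli_G _ mpos (funepos_ge0 _)).
move=> s _; apply: (@integral_normal_vec_slice_le R sig d theta i
  (fun z => (EFin \o B i)^\- (z, s)) (fun z => (EFin \o B i)^\+ (z, s)))%E.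
- by apply: (measurableT_comp mneg); exact: pair2_measurable.
- by apply: (measurableT_comp mpos); exact: pair2_measurable.
- by move=> z; exact: funeneg_ge0.
- by move=> z; exact: funepos_ge0.
- by move=> z; exact: slice_B.
Qed.

Let integral_A_pos_le_neg i :
  (\int[law]_zs (EFin \o A i)^\+ zs <= \int[law]_zs (EFin \o A i)^\- zs)%E.
Proof.
have mEA : measurable_fun [set: d.-tuple R * R] (EFin \o A i) by exact/measurable_EFinP.
have mpos := measurable_funepos mEA; have mneg := measurable_funeneg mEA.
rewrite [leLHS](fubini_tonelli1 _ mpos (funepos_ge0 _)).
rewrite [leRHS](fubini_tonelli1 _ mneg (funeneg_ge0 _)).
apply: ge0_le_integral => //.
- by move=> s _; exact: integral_ge0.
- exact: (measurable_fun_fubini_tonelli_F _ mpos (funepos_ge0 _)).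
- exact: (measurable_fun_fubini_tonelli_F _ mneg (funeneg_ge0 _)).
move=> z _.
(* With z fixed, the argument of phi decreases with s, and
   v^2 / sigma^2 - v is proportional to s (s - (n + 2) sigma^2). *)
pose k := h i z ^+ 2 / ((n%:R + 2) ^+ 2 * sigma2).
have k0 : 0 <= k by rewrite divr_ge0 ?sqr_ge0// mulr_ge0 ?sqr_ge0 ?(ltW sigma2_gt0).
pose psi s := (good (z, s))%:R * (k * phi (arg (z, s)) ^+ 2).
have := @chi2_nonincreasing_weight R n sigma2 (k * K ^+ 2) psi (fun s => A i (z, s)) sigma2_gt0.
have -> : (\int[chi]_s (EFin \o (fun s0 => A i (z, s0)))^\+ s =
    \int[chi]_s (EFin \o A i)^\+ (z, s))%E.
  by apply: eq_integral => s _; rewrite !funeposE.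
have -> : (\int[chi]_s (EFin \o (fun s0 => A i (z, s0)))^\- s =
    \int[chi]_s (EFin \o A i)^\- (z, s))%E.
  by apply: eq_integral => s _; rewrite !funenegE.
apply.
- apply: measurable_funM; first by apply: (measurableT_comp mgood); exact: pair1_measurable.
  apply: measurable_funM => //; apply: measurable_funX.
  by apply: (measurableT_comp mphi_arg); exact: pair1_measurable.
- move=> s; have /andP[f0 fK] := phi_bd (arg (z, s)).
  have f2 : phi (arg (z, s)) ^+ 2 <= K ^+ 2 by rewrite ler_pXn2r ?nnegrE.
  have kf : k * phi (arg (z, s)) ^+ 2 <= k * K ^+ 2 by rewrite ler_wpM2l.
  rewrite /psi; case: (good _); rewrite ?mul1r ?mul0r; apply/andP; split.
  - exact: (mulr_ge0 k0 (sqr_ge0 _)).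
  - exact: kf.
  - exact: lexx.
  - exact: (mulr_ge0 k0 (sqr_ge0 _)).
- move=> s t s0 st; rewrite /psi.
  have -> : good (z, t) = good (z, s) by rewrite /good/= (ltW s0) (ltW (lt_le_trans s0 st)).
  rewrite ler_wpM2l// ler_wpM2l//.
  have /andP[f0 _] := phi_bd (arg (z, s)); have /andP[f0' _] := phi_bd (arg (z, t)).
  rewrite ler_pXn2r ?nnegrE//; apply: phi_mono; rewrite /arg/= ler_wpM2l ?lp_norm_ge0//.
  have vs : 0 < vhat s by rewrite divr_gt0.
  have vst : vhat s <= vhat t by rewrite ler_pM2r ?invr_gt0.
  by rewrite lef_pV2 ?posrE ?sqrtr_gt0 ?(lt_le_trans vs)// ler_sqrt// (le_trans (ltW vs)).
- move=> s; rewrite /A /psi /k /vhat/=; field.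
  by rewrite !gt_eqF.
Qed.

(* An integrable bound for the square and the derivative of the shrinkage
   direction, which are unbounded near the hyperplane z_i = 0 and near the origin. *)
Let W i (z : d.-tuple R) := \prod_(j < d) `|tnth z j| `^
  (- (if j == i then (1 + alpha) / 2 else (3 - alpha) / (2 * (d%:R - 1)))).
Let q i (z : d.-tuple R) := (tnth z i - tnth theta i) ^+ 2.

Let W_ge0 i z : 0 <= W i z.
Proof. by apply: prodr_ge0 => j _; exact: powR_ge0. Qed.

Let q_ge0 i z : 0 <= q i z. Proof. exact: sqr_ge0. Qed.

Let mW i : measurable_fun [set: d.-tuple R] (W i).
Proof.
apply: measurable_prod => j _; apply: (measurableT_comp (measurable_powR _)).
exact: mcoord.
Qed.

Let mq i : measurable_fun [set: d.-tuple R] (q i).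
Proof.
apply: measurable_funX; apply: measurable_funB => //; exact: measurable_tnth.
Qed.

Let integral_q i : (\int[nu]_z (q i z)%:E = sigma2%:E)%E.
Proof.
apply: (@ge0_integral_normal_vec_coord R d sig theta i (fun x => (x - tnth theta i) ^+ 2)).
- by apply: measurable_funX; exact: measurable_funB.
- by move=> x; exact: sqr_ge0.
- by rewrite normal_moment2// sig2E.
Qed.

Let integrable_qW i : nu.-integrable [set: d.-tuple R] (EFin \o (fun z => q i z + W i z)).
Proof.
have iq : nu.-integrable [set: d.-tuple R] (EFin \o q i).
  apply/integrableP; split; first exact/measurable_EFinP.
  by under eq_integral do rewrite /= ger0_norm//; rewrite integral_q ltry.
have iW : nu.-integrable [set: d.-tuple R] (EFin \o W i).
  apply/integrableP; split; first exact/measurable_EFinP.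
  under eq_integral do rewrite /= ger0_norm//.
  exact: integral_powRN_prod_lty.
by apply: eq_integrable (integrableD measurableT iq iW).
Qed.

Let dominated_integrable (f : d.-tuple R * R -> R) (C : R) i : 0 <= C ->
  measurable_fun [set: d.-tuple R * R] f ->
  (forall zs, `|f zs| <= C * ((q i zs.1 + W i zs.1) * (`|zs.2| + zs.2 ^+ 2))) ->
  law.-integrable [set: d.-tuple R * R] (EFin \o f).
Proof.
move=> C0 mf fC.
have := integrable_prod_mul (integrable_qW i) (integrable_scaled_chi2 n (ltW sigma2_gt0)).
move=> /(integrableZl measurableT C) iD.
apply: le_integrable iD => //; first exact/measurable_EFinP.
move=> zs _; rewrite /= lee_fin; apply: le_trans (fC zs) _; exact: ler_norm.
Qed.

Let good_bounds zs i : good zs ->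
  [/\ 0 <= vhat zs.2 <= `|zs.2|, vhat zs.2 ^+ 2 <= zs.2 ^+ 2,
      h i zs.1 ^+ 2 <= W i zs.1 & `|D i zs.1| <= 3 * W i zs.1].
Proof.
move=> /andP[/forallP z0 s0].
have v0 : 0 <= vhat zs.2 by rewrite vhat_ge0.
have vs : vhat zs.2 <= zs.2.
  have n1 : 1 <= n%:R + 2 :> R by rewrite -[leLHS]add0r lerD// ler1n.
  by rewrite /vhat ler_pdivrMr// ler_peMr.
have t0 : 0 < `|tnth zs.1 i| <= lp_norm p zs.1 by rewrite normr_gt0 z0 lp_norm_ge.
have w := shrink_weight_le i d3 p0 alpha1 z0.
split.
- by rewrite v0 (ger0_norm s0).
- by rewrite ler_pXn2r ?nnegrE.
- exact: le_trans (shrink_sqr_le alpha1 t0) w.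
- apply: le_trans (dshrink_le p0 alpha0 alpha1 t0) _; exact: (ler_wpM2l (ler0n R 3) w).
Qed.

Let integrable_A i : law.-integrable [set: d.-tuple R * R] (EFin \o A i).
Proof.
have sV : 0 <= sigma2^-1 by rewrite invr_ge0 ltW.
apply: (@dominated_integrable _ (K ^+ 2 * (sigma2^-1 + 1)) i) => //.
  by rewrite mulr_ge0 ?sqr_ge0// addr_ge0.
move=> zs; have g0 : 0 <= (q i zs.1 + W i zs.1) * (`|zs.2| + zs.2 ^+ 2).
  by rewrite mulr_ge0// addr_ge0// sqr_ge0.
rewrite /A; have [gz|_] := boolP (good zs); last first.
  by rewrite mul0r normr0 mulr_ge0// mulr_ge0 ?sqr_ge0// addr_ge0.
rewrite mul1r; have [/andP[v0 vs] v2 hW _] := good_bounds i gz.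
have /andP[f0 fK] := phi_bd (arg zs).
have f2 : phi (arg zs) ^+ 2 <= K ^+ 2 by rewrite ler_pXn2r ?nnegrE.
have q0 := q_ge0 i zs.1; have s20 := sqr_ge0 zs.2; have as0 := normr_ge0 zs.2.
have vb : `|vhat zs.2 ^+ 2 / sigma2 - vhat zs.2| <= (sigma2^-1 + 1) * (`|zs.2| + zs.2 ^+ 2).
  have vv : 0 <= vhat zs.2 ^+ 2 / sigma2 <= zs.2 ^+ 2 / sigma2.
    by rewrite mulr_ge0 ?sqr_ge0//= ler_wpM2r.
  move: (vhat zs.2) (vhat zs.2 ^+ 2 / sigma2) (sigma2^-1) sV vv v0 vs => v w e e0 /andP[w0 we] v0 vs.
  rewrite ler_norml; apply/andP; split; nra.
rewrite (normrM (h i zs.1 ^+ 2 * phi (arg zs) ^+ 2)) (normrM (h i zs.1 ^+ 2)).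
rewrite (ger0_norm (sqr_ge0 (h i zs.1))) (ger0_norm (sqr_ge0 (phi (arg zs)))).
have hWq : h i zs.1 ^+ 2 <= q i zs.1 + W i zs.1 by rewrite (le_trans hW)// lerDr.
have -> : K ^+ 2 * (sigma2^-1 + 1) * ((q i zs.1 + W i zs.1) * (`|zs.2| + zs.2 ^+ 2)) =
  (q i zs.1 + W i zs.1) * K ^+ 2 * ((sigma2^-1 + 1) * (`|zs.2| + zs.2 ^+ 2)) by ring.
apply: ler_pM => //; first by rewrite mulr_ge0 ?sqr_ge0.
by apply: ler_pM => //; exact: sqr_ge0.
Qed.

Let integrable_B i : law.-integrable [set: d.-tuple R * R] (EFin \o B i).
Proof.
have sV : 0 <= sigma2^-1 by rewrite invr_ge0 ltW.
have s23 : 0 <= 1 + 3 * sigma2 by rewrite addr_ge0// mulr_ge0// ltW.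
apply: (@dominated_integrable _ (K / sigma2 * (1 + 3 * sigma2)) i) => //.
  by apply: mulr_ge0 => //; exact: mulr_ge0.
move=> zs; have g0 : 0 <= (q i zs.1 + W i zs.1) * (`|zs.2| + zs.2 ^+ 2).
  by rewrite mulr_ge0// addr_ge0// sqr_ge0.
rewrite /B; have [gz|_] := boolP (good zs); last first.
  by rewrite mul0r normr0; apply: mulr_ge0 => //; apply: mulr_ge0 => //; exact: mulr_ge0.
rewrite mul1r; have [/andP[v0 vs] v2 hW DW] := good_bounds i gz.
have /andP[f0 fK] := phi_bd (arg zs).
have q0 := q_ge0 i zs.1; have W0 := W_ge0 i zs.1.
have vf : `|vhat zs.2 * phi (arg zs) / sigma2| <= (`|zs.2| + zs.2 ^+ 2) * (K / sigma2).
  rewrite (normrM (vhat zs.2 * phi (arg zs))) (normrM (vhat zs.2)) [leRHS]mulrA.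
  rewrite (ger0_norm v0) (ger0_norm f0) (ger0_norm sV).
  apply: (ler_wpM2r sV); apply: ler_pM => //.
  by apply: le_trans vs _; rewrite lerDl sqr_ge0.
have zb : `|(tnth zs.1 i - tnth theta i) * h i zs.1 - sigma2 * D i zs.1| <=
    (1 + 3 * sigma2) * (q i zs.1 + W i zs.1).
  apply: le_trans (ler_normB _ _) _.
  have e1 : `|(tnth zs.1 i - tnth theta i) * h i zs.1| <= q i zs.1 + W i zs.1.
    apply: (@le_trans _ _ (q i zs.1 + h i zs.1 ^+ 2)); last by rewrite lerD2l.
    rewrite /q; move: (tnth zs.1 i - tnth theta i) (h i zs.1) => a b.
    by rewrite ler_norml; apply/andP; split; nra.
  have e2 : `|sigma2 * D i zs.1| <= 3 * sigma2 * (q i zs.1 + W i zs.1).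
    rewrite normrM (gtr0_norm sigma2_gt0) [3 * _]mulrC -mulrA ler_pM2l//.
    by apply: le_trans DW _; rewrite ler_pM2l// lerDr.
  by rewrite [leRHS]mulrDl mul1r; exact: lerD.
rewrite normrM.
have -> : K / sigma2 * (1 + 3 * sigma2) * ((q i zs.1 + W i zs.1) * (`|zs.2| + zs.2 ^+ 2)) =
  (`|zs.2| + zs.2 ^+ 2) * (K / sigma2) * ((1 + 3 * sigma2) * (q i zs.1 + W i zs.1)) by ring.
exact: ler_pM.
Qed.

Let good_ae : {ae law, forall zs, good zs}.
Proof.
pose z0 (x : R) : R := (x == 0)%:R.
pose neg (x : R) : R := (~~ (0 <= x))%R%:R.
have mz0 : measurable_fun [set: R] z0 by exact: measurable_eq0.
have mneg : measurable_fun [set: R] neg.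
  have -> : neg = fun x => 1 - (0 <= x)%R%:R.
    by apply/funext => x; rewrite /neg; case: (0 <= x); rewrite /= ?subrr ?subr0.
  by apply: measurable_funB => //; exact: measurable_nneg.
apply: ae_of_integral0; first exact: mgood.
apply/eqP; rewrite eq_le integral_ge0// andbT.
have Iz i : (\int[law]_zs (z0 (tnth zs.1 i))%:E = 0)%E.
  rewrite [LHS](ge0_integral_prod_fst nu chi (f := fun z => (z0 (tnth z i))%:E)).
  - apply: (@ge0_integral_normal_vec_coord R d sig theta i z0) => //.
    by rewrite normal_law_null.
  - by apply/measurable_EFinP; apply: (measurableT_comp mz0); exact: measurable_tnth.
  - by move=> z; rewrite lee_fin.
have Is : (\int[law]_zs (neg zs.2)%:E = 0)%E.
  rewrite [LHS](ge0_integral_prod_snd nu chi (f := fun s => (neg s)%:E)).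
  - rewrite ge0_integral_scaled_chi2//; [|exact/measurable_EFinP|by move=> s; rewrite lee_fin].
    rewrite integral0_eq// => x _; rewrite /neg sum_sqr_ge0//; exact: ltW.
  - exact/measurable_EFinP.
  - by move=> s; rewrite lee_fin.
have mzi i : measurable_fun [set: d.-tuple R * R] (fun zs => (z0 (tnth zs.1 i))%:E).
  apply/measurable_EFinP; apply: (measurableT_comp mz0).
  by apply: (measurableT_comp (measurable_tnth i)); exact: measurable_fst.
have ms : measurable_fun [set: d.-tuple R * R] (fun zs => (neg zs.2)%:E).
  by apply/measurable_EFinP; apply: (measurableT_comp mneg); exact: measurable_snd.
have mS : measurable_fun [set: d.-tuple R * R] (fun zs => \sum_(i < d) (z0 (tnth zs.1 i))%:E)%E.
  by apply: emeasurable_sum => i; exact: mzi.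
have sum0 : (\int[law]_zs (\sum_(i < d) (z0 (tnth zs.1 i))%:E + (neg zs.2)%:E) = 0)%E.
  have z_ge0 zs : (0 <= \sum_(i < d) (z0 (tnth zs.1 i))%:E)%E.
    by rewrite sumEFin lee_fin; exact: sumr_ge0.
  rewrite ge0_integralD//; last by move=> zs _; rewrite lee_fin.
  rewrite Is adde0 ge0_integral_sum//; last by move=> i zs _; rewrite lee_fin.
  by rewrite big1// => i _; exact: Iz.
rewrite -[leRHS]sum0; apply: ge0_le_integral => //.
- apply/measurable_EFinP.
  have -> : (fun zs => (~~ good zs)%:R : R) = fun zs => 1 - (good zs)%:R.
    by apply/funext => zs; case: (good zs); rewrite /= ?subrr ?subr0.
  exact: measurable_funB.
- exact: emeasurable_funD.
move=> zs _; rewrite sumEFin -EFinD lee_fin.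
have S0 : 0 <= \sum_(i < d) z0 (tnth zs.1 i) by exact: sumr_ge0.
have [gz|] := boolP (good zs); first by rewrite /= addr_ge0.
rewrite negb_and => /orP[/forallPn[i]|s0].
  rewrite negbK => zi; rewrite (bigD1 i)//= {1}/z0 zi -addrA lerDl addr_ge0//.
  exact: sumr_ge0.
by rewrite [X in _ + X]/neg s0 lerDr.
Qed.

Let Y_ge0 zs : 0 <= Y zs.
Proof.
have [gz|bad] := boolP (good zs).
  by apply: le_trans (loss_le_Y gz); apply: loss_ge0; exact: ltW.
apply: sumr_ge0 => i _; rewrite /A /B (negbTE bad) !mul0r mulr0 subrr addr0.
by apply: divr_ge0; [exact: sqr_ge0|exact: ltW].
Qed.

Lemma risk_le : (risk n (theta_hat n p alpha phi) theta sigma2 <= d%:R%:E)%E.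
Proof.
rewrite /risk unlock.
apply: (@integral_le_card _ _ _ law d (fun zs => loss (theta_hat n p alpha phi zs) theta sigma2)
  (fun i zs => q i zs.1 / sigma2) A B).
- by apply: measurable_loss2; [exact: theta_hat_estimator|exact: measurable_cst].
- by move=> zs; apply: loss_ge0; exact: ltW.
- by move=> i; apply: measurable_funM => //; apply: (measurableT_comp (mq i)); exact: measurable_fst.
- by move=> i zs; apply: divr_ge0 => //; exact: ltW.
- move=> i; rewrite [LHS](ge0_integral_prod_fst nu chi (f := fun z => (q i z / sigma2)%:E)).
  + under eq_integral do rewrite mulrC EFinM.
    rewrite ge0_integralZl//.
    * by rewrite integral_q -EFinM mulVf// gt_eqF.
    * exact/measurable_EFinP.
    * by move=> z _; rewrite lee_fin.
    * by rewrite lee_fin invr_ge0 ltW.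
  + by apply/measurable_EFinP; apply: measurable_funM.
  + by move=> z; rewrite lee_fin; apply: divr_ge0 => //; exact: ltW.
- exact: integrable_A.
- exact: integrable_B.
- exact: integral_A_pos_le_neg.
- exact: integral_B_neg_le_pos.
- exact: Y_ge0.
- by apply: filterS good_ae => zs; exact: loss_le_Y.
Qed.

End fixed_parameter.

Lemma sup_risk_le : (sup_risk n (theta_hat n p alpha phi : d.-tuple R * R -> _) <= d%:R%:E)%E.
Proof.
apply: ge_ereal_sup => _ [theta [sigma2 s0 ->]]; exact: risk_le.
Qed.

End shrinkage_risk.

Theorem theorem3p1 (R : realType) (d n : nat) (p alpha : R) (phi : R -> R)
    (hd : (3 <= d)%N) (hn : (1 <= n)%N) (hp : 0 < p)
    (halpha0 : 0 <= alpha) (halpha : alpha < (d%:R - 2) / (d%:R - 1))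
    (hphi_ac : abs_continuous_nonneg phi)
    (hphi_mono : forall u v : R, 0 <= u -> u <= v -> phi u <= phi v)
    (hphi_bound : forall u : R, 0 <= u ->
       0 <= phi u <= 2 * (d%:R - 2) * gamma_bound d p alpha) :
  minimax n (@theta_hat R d n p alpha phi).
Proof.
(* phi is only evaluated on [0, +oo[, so it may be made constant on ]-oo, 0],
   which makes it monotone and hence measurable on the whole line. *)
pose psi u := phi (Num.max 0 u).
have -> : @theta_hat R d n p alpha phi = theta_hat n p alpha psi.
  apply/funext => -[z s]; apply/eq_from_tnth => i.
  by rewrite !tnth_mktuple /psi max_r// divr_ge0 ?sqrtr_ge0 ?powR_ge0.
have psi_mono u v : u <= v -> psi u <= psi v.
  move=> uv; apply: hphi_mono; first by rewrite le_max lexx.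
  by rewrite ge_max !le_max lexx uv orbT.
have psi_bd u : 0 <= psi u <= 2 * (d%:R - 2) * gamma_bound d p alpha.
  by apply: hphi_bound; rewrite le_max lexx.
split; first exact: theta_hat_estimator psi_mono.
move=> delta mdelta; apply: le_trans (sup_risk_ge _ mdelta).
exact: (sup_risk_le n hd hp halpha0 halpha psi_mono psi_bd (lexx _)).
Qed.
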